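(* Let $M$ be a countable, $\omega$-categorical structure with $M=M^{eq}$, and let $G=\mathrm{Aut}(M)$ with the pointwise convergence topology. Then the homomorphism $\rho\colon\mathrm{Aut}(M^* )/\mathrm{Autf}_L(M^* )\to G^{**}/{G^{**}}^{000}_{\mathrm{top}}$ is a group isomorphism.
   Context: Let $T=\mathrm{Th}(M)$. Let $\mathcal M$ be the structure consisting of $M$, the group $G$, the action of $G$ on $M$, and predicates for all open subsets of $G$. Let $\mathcal M^{**}=(M^{**},G^{**},\dots)\succ\mathcal M^*=(M^*,G^*,\dots)\succ\mathcal M=(M,G,\dots)$, where $\mathcal M^*$ is a monster model of $\mathrm{Th}(\mathcal M)$, $\mathcal M^{**}$ is a monster model with respect to $\mathcal M^*$ (in particular $|\mathcal M^*|^+$-saturated), and $M^{**}\succ M^*\succ M$ are monster models of $T$ (monster model: $\kappa$-saturated and strongly $\kappa$-homogeneous for a sufficiently large strong limit $\kappa$). $\mathrm{Autf}_L(M^* )$ is the group of automorphisms of $M^*$ preserving all classes of the finest bounded $\emptyset$-invariant equivalence relation on every product of sorts; equivalently, the subgroup of $\mathrm{Aut}(M^* )$ generated by automorphisms fixing pointwise some small elementary submodel. (So $\mathrm{Aut}(M^* )/\mathrm{Autf}_L(M^* )=\mathrm{Gal}_L(T)$.) Let $\mu$ be the intersection of the interpretations $U^{**}$ in $\mathcal M^{**}$ of all open neighborhoods $U$ of the identity in $G$. ${G^{**}}^{000}_{\mathrm{top}}$ is the smallest normal, bounded index subgroup of $G^{**}$ which is invariant under $\mathrm{Aut}(\mathcal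 M^{**}/\mathcal M)$ and contains $\mu$. Let $H$ be the group of all $\sigma\in G^{**}$ whose action on $M^{**}$ fixes $M^*$ setwise. Every $\sigma\in\mathrm{Aut}(M^* )$ equals $\sigma'|_{M^*}$ for some $\sigma'\in H$, and the coset $\sigma'/{G^{**}}^{000}_{\mathrm{top}}$ depends only on $\sigma/\mathrm{Autf}_L(M^* )$; $\rho$ is the (well-defined) group homomorphism $\rho(\sigma/\mathrm{Autf}_L(M^* ))=\sigma'/{G^{**}}^{000}_{\mathrm{top}}$. *)

(* Defs.v *)
From HB Require Import structures.
From mathcomp Require Import all_boot.
From mathcomp Require Import boolp classical_sets functions cardinality.

Set Implicit Arguments.
Unset Strict Implicit.
Unset Printing Implicit Defensive.

Local Open Scope classical_set_scope.
Local Open Scope card_scope.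
Local Open Scope quotient_scope.

(* [idx n] has n elements.  It is used instead of ['I_n] because
   [idx n.+1 = option (idx n)] holds by computation, so that no transport along
   equalities of sorts is needed when a valuation is extended. *)
Fixpoint idx (n : nat) : Type := if n is m.+1 then option (idx m) else void.

Record lang := Lang {
  srt : Type;
  fsym : Type;
  farity : fsym -> nat;
  fdom : forall f, idx (farity f) -> srt;
  fcod : fsym -> srt;
  rsym : Type;
  rarity : rsym -> nat;
  rdom : forall r, idx (rarity r) -> srt }.

Record structure (L : lang) := Structure {
  carrier :> srt L -> Type;
  funI : forall f : fsym L,
    (forall i, carrier (@fdom L f i)) -> carrier (fcod f);
  relI : forall r : rsym L, (forall i, carrier (@rdom L r i)) -> Prop }.
Arguments funI {L} s f v : rename.
Arguments relI {L} s r v : rename.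

Definition elt (L : lang) (M : structure L) := {s : srt L & M s}.

(* A context of length n is a map [g : idx n -> S] giving the sorts of n free
   variables; [None] is the most recently bound variable. *)
Definition nilc (S : Type) : idx 0 -> S := fun i : void => match i with end.

Definition scons (S : Type) (n : nat) (s : S) (g : idx n -> S) :
    idx n.+1 -> S :=
  fun i => if i is Some j then g j else s.

Section Logic.
Variable L : lang.
Local Notation S := (srt L).

Inductive term (n : nat) (g : idx n -> S) : S -> Type :=
| Var (i : idx n) : term g (g i)
| App (f : fsym L) (a : forall i, term g (@fdom L f i)) : term g (fcod f).

Inductive form : forall n : nat, (idx n -> S) -> Type :=
| Bot n (g : idx n -> S) : form g
| Eq n (g : idx n -> S) (s : S) (t u : term g s) : form g
| Rel n (g : idx n -> S) (r : rsym L)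
    (a : forall i, term g (@rdom L r i)) : form g
| Imp n (g : idx n -> S) (p q : form g) : form g
| All n (g : idx n -> S) (s : S) (p : form (scons s g)) : form g.

Definition formula := {n : nat & {g : idx n -> S & form g}}.

Variable M : structure L.

Definition nilv : forall i : idx 0, M (nilc S i) :=
  fun i : void => match i with end.

Definition vcons n (g : idx n -> S) (s : S) (x : M s) (v : forall i, M (g i)) :
    forall i, M (scons s g i) :=
  fun i => match i as i return M (scons s g i) with
           | Some j => v j
           | None => x
           end.

Fixpoint eval n (g : idx n -> S) (v : forall i, M (g i)) (s : S)
    (t : term g s) : M s :=
  match t with
  | Var i => v i
  | App f a => funI M f (fun i => eval v (a i))
  end.

Fixpoint sat n (g : idx n -> S) (p : form g) : (forall i, M (g i)) -> Prop :=
  match p with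
  | Bot _ _ => fun=> False
  | Eq _ _ _ t u => fun v => eval v t = eval v u
  | Rel _ _ r a => fun v => relI M r (fun i => eval v (a i))
  | Imp _ _ p q => fun v => sat p v -> sat q v
  | All _ _ s p => fun v => forall x : M s, sat p (vcons x v)
  end.

(* 0-definability of a relation on a family of variables with sorts [d];
   [e] says which of these variables the formula mentions. *)
Definition definable (I : Type) (d : I -> S) (X : set (forall i, M (d i))) :=
  exists (n : nat) (e : idx n -> I) (p : form (fun i => d (e i))),
    forall v, X v <-> sat p (fun i => v (e i)).

End Logic.

Definition elem_equiv (L : lang) (M N : structure L) :=
  forall p : form (@nilc (srt L)), sat p (@nilv L M) <-> sat p (@nilv L N).

Record elem_emb (L : lang) (M N : structure L) := ElemEmb {
  emb :> forall s, M s -> N s;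
  emb_elem : forall n (g : idx n -> srt L) (p : form g) (v : forall i, M (g i)),
    sat p v <-> sat p (fun i => emb (v i)) }.

Definition emb_comp (L : lang) (M N P : structure L)
    (i : elem_emb M N) (j : elem_emb N P) : elem_emb M P.
Proof.
apply: (@ElemEmb _ _ _ (fun s x => j s (i s x))) => n g p v.
exact: iff_trans (emb_elem i p v) (emb_elem j p (fun k => i _ (v k))).
Defined.

Record iso (L : lang) (M N : structure L) := Iso {
  isof :> forall s, M s -> N s;
  isov : forall s, N s -> M s;
  isofK : forall s, cancel (isof (s := s)) (isov (s := s));
  isovK : forall s, cancel (isov (s := s)) (isof (s := s));
  iso_fun : forall f v, isof (funI M f v) = funI N f (fun i => isof (v i));
  iso_rel : forall r v, relI M r v <-> relI N r (fun i => isof (v i)) }.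

Definition isomorphic (L : lang) (M N : structure L) := inhabited (iso M N).

Definition aut (L : lang) (M : structure L) := iso M M.

HB.instance Definition _ (L : lang) (M : structure L) := gen_eqMixin (aut M).
HB.instance Definition _ (L : lang) (M : structure L) :=
  gen_choiceMixin (aut M).

Section AutGroup.
Variables (L : lang) (M : structure L).

Lemma aut_ext (x y : aut M) : (forall s (a : M s), x s a = y s a) -> x = y.
Proof.
case: x y => f f' fK f'K ff fr [h h' hK h'K hf hr] /= fh.
have efh : f = h by apply: functional_extensionality_dep => s; apply: funext.
subst h.
have efh' : f' = h'.
  apply: functional_extensionality_dep => s; apply: funext => a.
  by rewrite -[in LHS](h'K s a) fK.
by subst h'; congr Iso; exact: Prop_irrelevance.
Qed.

Definition aut1 : aut M.
Proof. by apply: (@Iso _ _ _ (fun s x => x) (fun s x => x)). Defined.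

Definition autV (x : aut M) : aut M.
Proof.
apply: (@Iso _ _ _ (isov x) x (isovK x) (isofK x)) => [f v|r v].
  apply: (can_inj (isofK x (s := _))); rewrite isovK iso_fun; congr funI.
  by apply: functional_extensionality_dep => i; rewrite isovK.
rewrite (iso_rel x (fun i => isov x (v i))).
suff -> : (fun i => x _ (isov x (v i))) = v by [].
by apply: functional_extensionality_dep => i; rewrite isovK.
Defined.

Definition autM (x y : aut M) : aut M.
Proof.
apply: (@Iso _ _ _ (fun s a => x s (y s a)) (fun s a => isov y (isov x a))).
- by move=> s a; rewrite !isofK.
- by move=> s a; rewrite !isovK.
- by move=> f v; rewrite !iso_fun.
- by move=> r v; rewrite (iso_rel y) (iso_rel x).
Defined.

Lemma autMA : associative autM. Proof. by move=> x y z; apply: aut_ext. Qed.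
Lemma aut1M : left_id aut1 autM. Proof. by move=> x; apply: aut_ext. Qed.
Lemma autM1 : right_id aut1 autM. Proof. by move=> x; apply: aut_ext. Qed.
Lemma autVM : left_inverse aut1 autV autM.
Proof. by move=> x; apply: aut_ext => s a /=; rewrite isofK. Qed.
Lemma autMV : right_inverse aut1 autV autM.
Proof. by move=> x; apply: aut_ext => s a /=; rewrite isovK. Qed.

HB.instance Definition _ :=
  isGroup.Build (aut M) autMA aut1M autM1 autVM autMV.

End AutGroup.

Lemma iso_eval (L : lang) (M N : structure L) (x : iso M N) n
    (g : idx n -> srt L) (v : forall i, M (g i)) s (t : term g s) :
  x s (eval v t) = eval (fun i => x _ (v i)) t.
Proof.
elim: t => //= f a IH; rewrite iso_fun; congr funI.
exact: functional_extensionality_dep.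
Qed.

Lemma iso_sat (L : lang) (M N : structure L) (x : iso M N) n
    (g : idx n -> srt L) (p : form g) (v : forall i, M (g i)) :
  sat p v <-> sat p (fun i => x _ (v i)).
Proof.
elim: p v => {n g} /= [n g|n g s t u|n g r a|n g p IHp q IHq|n g s p IH] v.
- by [].
- by rewrite -!iso_eval; split=> [->//|/(can_inj (isofK x (s := s)))].
- apply: (iff_trans (iso_rel x _)).
  suff -> : (fun i => x _ (eval v (a i))) =
            (fun i => eval (fun j => x _ (v j)) (a i)) by [].
  by apply: functional_extensionality_dep => i; rewrite iso_eval.
- by split=> h /IHp/h/IHq.
- have E (a : M s) : (fun i => x _ (vcons a v i)) =
              vcons (x s a) (fun i => x _ (v i)).
    by apply: functional_extensionality_dep; case.
  split=> h a.
    by rewrite -(isovK x a) -E -IH.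
  by apply/IH; rewrite E.
Qed.

(* Open sets for pointwise convergence: a basic neighbourhood of [g] consists of
   the automorphisms agreeing with [g] on a finite set [F]. *)
Definition open_aut (L : lang) (M : structure L) (U : set (aut M)) :=
  forall g, U g -> exists F : set (elt M), finite_set F /\
    forall h : aut M,
      (forall s (a : M s), F (existT _ s a) -> h s a = g s a) -> U h.

(* |A| < |K|; cardinals are represented by types. *)
Definition small (K T : Type) (A : set T) : Prop :=
  A #<= [set: K] /\ ~ ([set: K] #<= A).

Definition strong_limit (K : Type) :=
  forall A : set K, small K A -> small K [set B | B `<=` A].

Section Monster.
Variables (K : Type) (L : lang) (M : structure L).

Definition params n (g : idx n -> srt L) (v : forall i, M (g i)) : set (elt M) :=
  [set existT M (g i) (v i) | i in [set: idx n]].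

(* The free variable has sort [s]; [pf_val] gives the parameters. *)
Record pform (s : srt L) := PForm {
  pf_n : nat;
  pf_ctx : idx pf_n -> srt L;
  pf_form : form (scons s pf_ctx);
  pf_val : forall i, M (pf_ctx i) }.

Arguments pf_val [s] p i : rename.

Definition psat s (p : pform s) (x : M s) := sat (pf_form p) (vcons x (pf_val p)).

Definition saturated :=
  forall (A : set (elt M)) (s : srt L) (P : set (pform s)),
    small K A ->
    (forall p, P p -> params (pf_val p) `<=` A) ->
    (forall F : set (pform s), finite_set F -> F `<=` P ->
       exists x, forall p, F p -> psat p x) ->
    exists x, forall p, P p -> psat p x.

Definition strongly_homogeneous :=
  forall (A : set (elt M)) (f : forall s, M s -> M s),
    small K A ->
    (forall n (g : idx n -> srt L) (p : form g) (v : forall i, M (g i)),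
       params v `<=` A -> (sat p v <-> sat p (fun i => f _ (v i)))) ->
    exists x : aut M, forall s (a : M s), A (existT _ s a) -> x s a = f s a.

Definition monster :=
  [/\ strong_limit K, saturated & strongly_homogeneous].

End Monster.

(* The lower bound meant by "sufficiently large": K exceeds the size of the
   structure and of its language. *)
Definition large (K : Type) (L : lang) (M : structure L) :=
  small K [set: elt M] /\ small K [set: formula L].

Definition countable_structure (L : lang) (M : structure L) :=
  countable [set: elt M].

(* As usual, omega-categoricity refers to theories in countable languages. *)
Definition omega_categorical (L : lang) (M : structure L) :=
  [/\ countable [set: srt L], countable [set: fsym L], countable [set: rsym L] &
    forall N : structure L,
      countable_structure N -> elem_equiv M N -> isomorphic M N].

Definition pair_sort (S : Type) n (g : idx n -> S) (i : idx n + idx n) : S :=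
  match i with inl k => g k | inr k => g k end.

Definition pair_val (L : lang) (M : structure L) n (g : idx n -> srt L)
    (a b : forall i, M (g i)) : forall i, M (pair_sort g i) :=
  fun i => match i as i return M (pair_sort g i) with
           | inl k => a k
           | inr k => b k
           end.

(* Every quotient of a finite product of sorts by a 0-definable equivalence
   relation E is, via a 0-definable map [f], a sort of M. *)
Definition equals_eq (L : lang) (M : structure L) :=
  forall n (g : idx n -> srt L) (E : set (forall i, M (pair_sort g i))),
    definable E ->
    (forall a, E (pair_val a a)) ->
    (forall a b, E (pair_val a b) -> E (pair_val b a)) ->
    (forall a b c, E (pair_val a b) -> E (pair_val b c) -> E (pair_val a c)) ->
    exists (s : srt L) (f : (forall i, M (g i)) -> M s),
      [/\ definable [set v : forall i, M (scons s g i) |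
                       v None = f (fun i => v (Some i))],
          forall x, exists a, f a = x &
          forall a b, f a = f b <-> E (pair_val a b)].

Definition subgroup (G : groupType) (N : set G) :=
  [/\ N 1%g, forall x y, N x -> N y -> N (x * y)%g & forall x, N x -> N x^-1%g].

Definition normal (G : groupType) (N : set G) :=
  subgroup N /\ forall x y, N x -> N (x ^ y)%g.

Definition coset (G : groupType) (N : set G) (x : G) : set G :=
  [set y | N (x^-1 * y)%g].

Definition bounded_index (K : Type) (G : groupType) (N : set G) :=
  small K [set coset N x | x in [set: G]].

Record nsubgroup (G : groupType) :=
  NSubgroup { nset :> set G; nsetP : normal nset }.

Section Quotient.
Variables (G : groupType) (N : nsubgroup G).

Definition qrel (x y : G) : bool := `[< coset N x y >].

Lemma qrel_is_equiv : equiv_class_of qrel.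
Proof.
case: (nsetP N) => -[N1 NM NV] _.
have sym x y : qrel x y -> qrel y x.
  by move=> /asboolP /NV; rewrite invgM invgK => h; apply/asboolP.
split=> [x|x y|y x z].
- by apply/asboolP; rewrite /coset /= mulVg.
- by apply/idP/idP; exact: sym.
- move=> /asboolP h1 /asboolP h2; apply/asboolP.
  by have := NM _ _ h1 h2; rewrite -mulgA mulVKg.
Qed.

Canonical qrel_equiv := EquivRelPack qrel_is_equiv.
Canonical qrel_encModRel := defaultEncModRel qrel.

Definition quot := {eq_quot qrel}.
HB.instance Definition _ : EqQuotient G qrel quot := EqQuotient.on quot.
HB.instance Definition _ := Choice.on quot.

Definition quot1 : quot := \pi_quot 1%g.
Definition quotV (a : quot) : quot := \pi_quot (repr a)^-1%g.
Definition quotM (a b : quot) : quot := \pi_quot (repr a * repr b)%g.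

Lemma quotE x y : (\pi_quot x = \pi_quot y) <-> coset N x y.
Proof. by split=> [/eqmodP/asboolP|h]; last exact/eqmodP/asboolP. Qed.

Lemma pi_quotM x y : \pi_quot (x * y)%g = quotM (\pi_quot x) (\pi_quot y).
Proof.
case: (nsetP N) => -[N1 NM NV] NJ.
have /quotE hx : \pi_quot x = \pi_quot (repr (\pi_quot x)) by rewrite reprK.
have /quotE hy : \pi_quot y = \pi_quot (repr (\pi_quot y)) by rewrite reprK.
apply/quotE; move: hx hy; set x' := repr _; set y' := repr _; rewrite /coset /=.
move=> hx hy; have := NM _ _ (NJ _ y hx) hy.
by rewrite conjgE invgM !mulgA mulgK.
Qed.

Lemma pi_quotV x : \pi_quot x^-1%g = quotV (\pi_quot x).
Proof.
case: (nsetP N) => -[N1 NM NV] NJ.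
have /quotE hx : \pi_quot x = \pi_quot (repr (\pi_quot x)) by rewrite reprK.
apply/quotE; move: hx; set x' := repr _; rewrite /coset /= invgK => hx.
have := NJ _ x^-1%g (NV _ hx).
by rewrite conjgE invgM !invgK !mulgA mulgK.
Qed.

Lemma quotMA : associative quotM.
Proof.
by elim/(@quotW _ quot) => a; elim/(@quotW _ quot) => b; elim/(@quotW _ quot) => c; rewrite -!pi_quotM mulgA.
Qed.
Lemma quot1M : left_id quot1 quotM.
Proof. by elim/(@quotW _ quot) => a; rewrite -pi_quotM mul1g. Qed.
Lemma quotM1 : right_id quot1 quotM.
Proof. by elim/(@quotW _ quot) => a; rewrite -pi_quotM mulg1. Qed.
Lemma quotVM : left_inverse quot1 quotV quotM.
Proof. by elim/(@quotW _ quot) => a; rewrite -pi_quotV -pi_quotM mulVg. Qed.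
Lemma quotMV : right_inverse quot1 quotV quotM.
Proof. by elim/(@quotW _ quot) => a; rewrite -pi_quotV -pi_quotM mulgV. Qed.

HB.instance Definition _ :=
  isGroup.Build quot quotMA quot1M quotM1 quotVM quotMV.

End Quotient.

Section Autf.
Variables (K : Type) (L : lang) (M : structure L).

Definition fixes_small_model : set (aut M) :=
  [set x | exists (N : structure L) (e : elem_emb N M),
     small K [set: elt N] /\ forall s (a : N s), x s (e s a) = e s a].

(* [smallest subgroup X] is the intersection of all subgroups containing [X],
   i.e. the subgroup generated by [X]. *)
Definition AutfL_set : set (aut M) :=
  smallest (@subgroup (aut M)) fixes_small_model.

Lemma AutfL_normal : normal AutfL_set.
Proof.
split.
  split=> [A [[]]//|x y hx hy A hA|x hx A hA].
    by case: (hA) => -[_ h _] _; apply: h; [apply: hx|apply: hy].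
  by case: (hA) => -[_ _ h] _; apply: h; apply: hx.
move=> x y hx A [[A1 AM AV] FA].
apply: (hx [set z | A (z ^ y)%g]); split => [|z [N [e [sN fz]]]].
  split=> [|a b|a] /=.
  - by rewrite conj1g.
  - by rewrite conjMg; exact: AM.
  - by rewrite conjVg; exact: AV.
apply: FA.
have ye : forall n (g : idx n -> srt L) (p : form g) (v : forall i, N (g i)),
    sat p v <-> sat p (fun i => (y^-1)%g _ (e _ (v i))).
  move=> n g p v; apply: (iff_trans (emb_elem e p v)).
  exact: (iso_sat (y^-1)%g p (fun i => e _ (v i))).
exists N, (@ElemEmb _ _ _ (fun s a => (y^-1)%g s (e s a)) ye); split=> // s a /=.
by rewrite /= isovK fz.
Qed.

Definition AutfL : nsubgroup (aut M) := NSubgroup AutfL_normal.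

End Autf.

Section Expansion.
Variables (L : lang) (M : structure L).

(* [None] is the sort of the group, [Some s] is the sort [s] of [M]. *)
Definition esrt := option (srt L).

Inductive efsym :=
| EFun (f : fsym L)
| EOne
| EInv
| EMul
| EAct (s : srt L).

Inductive ersym :=
| ERel (r : rsym L)
| EOpen (U : set (aut M)) of open_aut U.

Definition efarity (f : efsym) : nat :=
  match f with
  | EFun f => farity f
  | EOne => 0
  | EInv => 1
  | EMul => 2
  | EAct _ => 2
  end.

Definition efdom (f : efsym) : idx (efarity f) -> esrt :=
  match f with
  | EFun f => fun i => Some (fdom i)
  | EOne | EInv | EMul => fun=> None
  | EAct s => fun i => if i is Some _ then Some s else None
  end.

Definition efcod (f : efsym) : esrt :=
  match f with
  | EFun f => Some (fcod f)
  | EOne | EInv | EMul => None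
  | EAct s => Some s
  end.

Definition erarity (r : ersym) : nat :=
  match r with ERel r => rarity r | EOpen _ _ => 1 end.

Definition erdom (r : ersym) : idx (erarity r) -> esrt :=
  match r with ERel r => fun i => Some (rdom i) | EOpen _ _ => fun=> None end.

Definition elang : lang := @Lang esrt efsym efarity efdom efcod ersym erarity erdom.

Definition ecarrier (s : esrt) : Type := if s is Some s then M s else aut M.

Definition efunI (f : efsym) :
    (forall i, ecarrier (@efdom f i)) -> ecarrier (efcod f) :=
  match f return (forall i, ecarrier (@efdom f i)) -> ecarrier (efcod f) with
  | EFun f => fun v => funI M f v
  | EOne => fun=> (1 : aut M)%g
  | EInv => fun v => ((v None : aut M)^-1)%g
  | EMul => fun v => ((v None : aut M) * (v (Some None) : aut M))%g
  | EAct s => fun v => (v None : aut M) s (v (Some None))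
  end.

Definition erelI (r : ersym) : (forall i, ecarrier (@erdom r i)) -> Prop :=
  match r return (forall i, ecarrier (@erdom r i)) -> Prop with
  | ERel r => fun v => relI M r v
  | EOpen U _ => fun v => U (v None)
  end.

Definition expansion : structure elang := @Structure elang ecarrier efunI erelI.

Variable N : structure elang.

Definition reduct : structure L :=
  @Structure L (fun s => N (Some s)) (fun f v => funI N (EFun f) v)
    (fun r v => relI N (ERel r) v).

Definition gone : N None := funI N EOne (fun i : void => match i with end).
Definition ginv (x : N None) : N None := funI N EInv (fun=> x).
Definition gmul (x y : N None) : N None :=
  funI N EMul (fun i => if i is Some _ then y else x).
Definition gact (x : N None) (s : srt L) (a : N (Some s)) : N (Some s) :=
  funI N (EAct s) (fun i => match i as i return N (@efdom (EAct s) i) with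
                            | Some _ => a
                            | None => x
                            end).
Definition gopen (U : set (aut M)) (oU : open_aut U) (x : N None) : Prop :=
  relI N (EOpen oU) (fun=> x).

End Expansion.

Arguments reduct [L M] N.
Arguments gone {L M} N.
Arguments ginv {L M N} x.
Arguments gmul {L M N} x y.
Arguments gact {L M N} x {s} a.
Arguments gopen {L M N} [U] oU x.

(* The group sort of an elementary extension of [expansion M]; the embedding
   is only used to know that the group axioms hold. *)
Definition Gext (L : lang) (M : structure L) (N : structure (elang M))
  (e : elem_emb (expansion M) N) : Type := N None.

HB.instance Definition _ L M N e := gen_eqMixin (@Gext L M N e).
HB.instance Definition _ L M N e := gen_choiceMixin (@Gext L M N e).

Section GroupAxioms.
Variables (L : lang) (M : structure L) (N : structure (elang M)).

Section Terms.
Variables (n : nat) (g : idx n -> srt (elang M)).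
Definition tone : term g None :=
  App (L := elang M) (f := EOne L) (fun i : void => match i with end).
Definition tinv (t : term g None) : term g None :=
  App (L := elang M) (f := EInv L) (fun=> t).
Definition tmul (t u : term g None) : term g None :=
  App (L := elang M) (f := EMul L) (fun i => if i is Some _ then u else t).

Lemma eval_tone (P : structure (elang M)) (v : forall i, P (g i)) :
  eval v tone = gone P.
Proof.
rewrite /gone /=; apply: (congr1 (funI P (EOne L : fsym (elang M)))).
by apply: functional_extensionality_dep; case.
Qed.
Lemma eval_tinv (P : structure (elang M)) (v : forall i, P (g i)) t :
  eval v (tinv t) = ginv (eval v t).
Proof. by []. Qed.
Lemma eval_tmul (P : structure (elang M)) (v : forall i, P (g i)) t u :
  eval v (tmul t u) = gmul (eval v t) (eval v u).
Proof.
rewrite /gmul /=; apply: (congr1 (funI P (EMul L : fsym (elang M)))).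
by apply: functional_extensionality_dep; case.
Qed.
End Terms.

Definition c1 : idx 1 -> srt (elang M) := scons None (@nilc _).
Definition c3 : idx 3 -> srt (elang M) := scons None (scons None c1).

Variable e : elem_emb (expansion M) N.
Local Notation X := (expansion M).

Lemma transfer1 (t u : term c1 None) :
  (forall v : forall i, X (c1 i), eval v t = eval v u) ->
  forall v : forall i, N (c1 i), eval v t = eval v u.
Proof.
move=> h v; have := (emb_elem e (All (Eq t u)) (@nilv _ X)).1 => /= H.
have {H} := H (fun x => h _) (v None) => /=.
set w := vcons _ _; suff -> : w = v by [].
by apply: functional_extensionality_dep; case=> // -[].
Qed.

Lemma transfer3 (t u : term c3 None) :
  (forall v : forall i, X (c3 i), eval v t = eval v u) ->
  forall v : forall i, N (c3 i), eval v t = eval v u.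
Proof.
move=> h v; have := (emb_elem e (All (All (All (Eq t u)))) (@nilv _ X)).1 => /= H.
have {H} := H (fun x y z => h _) (v (Some (Some None))) (v (Some None)) (v None).
set w := vcons _ _; suff -> : w = v by [].
by apply: functional_extensionality_dep; case=> // -[] // -[] // [].
Qed.

Let tx : term c1 None := Var (L := elang M) c1 None.

Definition val1 (x : N None) : forall i, N (c1 i) :=
  fun i => match i as i return N (c1 i) with
           | None => x | Some k => match k : void with end end.

Lemma Gext1M : left_id (gone N) (@gmul L M N).
Proof.
move=> x; have := @transfer1 (tmul (tone c1) tx) tx.
move=> /(_ _ (val1 x)); rewrite eval_tmul eval_tone; apply=> v.
by rewrite eval_tmul eval_tone; exact: (mul1g (v None : aut M)).
Qed.

Lemma GextM1 : right_id (gone N) (@gmul L M N).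
Proof.
move=> x; have := @transfer1 (tmul tx (tone c1)) tx.
move=> /(_ _ (val1 x)); rewrite eval_tmul eval_tone; apply=> v.
by rewrite eval_tmul eval_tone; exact: (mulg1 (v None : aut M)).
Qed.

Lemma GextVM : left_inverse (gone N) (@ginv L M N) (@gmul L M N).
Proof.
move=> x; have := @transfer1 (tmul (tinv tx) tx) (tone c1).
move=> /(_ _ (val1 x)); rewrite eval_tmul eval_tone; apply=> v.
by rewrite eval_tmul eval_tone; exact: (mulVg (v None : aut M)).
Qed.

Lemma GextMV : right_inverse (gone N) (@ginv L M N) (@gmul L M N).
Proof.
move=> x; have := @transfer1 (tmul tx (tinv tx)) (tone c1).
move=> /(_ _ (val1 x)); rewrite eval_tmul eval_tone; apply=> v.
by rewrite eval_tmul eval_tone; exact: (mulgV (v None : aut M)).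
Qed.

Lemma GextMA : associative (@gmul L M N).
Proof.
move=> x y z.
pose v : forall i, N (c3 i) := vcons x (vcons y (val1 z)).
pose t0 : term c3 None := Var (L := elang M) c3 None.
pose t1 : term c3 None := Var (L := elang M) c3 (Some None).
pose t2 : term c3 None := Var (L := elang M) c3 (Some (Some None)).
have := @transfer3 (tmul t0 (tmul t1 t2)) (tmul (tmul t0 t1) t2).
move=> /(_ _ v); rewrite !eval_tmul; apply=> w.
rewrite !eval_tmul.
exact: (mulgA (w None : aut M) (w (Some None) : aut M)
  (w (Some (Some None)) : aut M)).
Qed.

HB.instance Definition _ :=
  isGroup.Build (Gext e) GextMA Gext1M GextM1 GextVM GextMV.

End GroupAxioms.

Section G000.
Variables (K : Type) (L : lang) (M : structure L) (N : structure (elang M)).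
Variable e : elem_emb (expansion M) N.

Definition mu : set (Gext e) :=
  [set x | forall (U : set (aut M)) (oU : open_aut U), U 1%g -> gopen oU x].

Definition invariant (A : set (Gext e)) :=
  forall t : aut N,
    (forall s (a : expansion M s), t s (e s a) = e s a) ->
    [set t None x | x in A] = A.

Definition G000top_class : set (set (Gext e)) :=
  [set A | [/\ normal A, bounded_index K A & invariant A]].

Definition G000top_set : set (Gext e) := smallest G000top_class mu.

Lemma G000top_normal : normal G000top_set.
Proof.
split; first split=> [A [[[[]]]]//|x y hx hy A hA|x hx A hA].
- by case: (hA) => -[[[_ h _] _] _ _] _; apply: h; [apply: hx|apply: hy].
- by case: (hA) => -[[[_ _ h] _] _ _] _; apply: h; apply: hx.
- move=> x y hx A hA.
  by case: (hA) => -[[_ h] _ _] _; apply: h; apply: hx.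
Qed.

Definition G000top : nsubgroup (Gext e) := NSubgroup G000top_normal.

End G000.

Section Rho.
Variables (K K' : Type) (L : lang) (M : structure L).
Variables (M1 M2 : structure (elang M)).
Variables (i : elem_emb (expansion M) M1) (j : elem_emb M1 M2).

(* The elements of G** whose action on M** fixes M* setwise. *)
Definition Hstab : set (Gext (emb_comp i j)) :=
  [set x | forall s : srt L,
     [set gact (x : M2 None) a | a in range (j (Some s))] = range (j (Some s))].

Definition restricts_to (x : Gext (emb_comp i j)) (sigma : aut (reduct M1)) :=
  forall (s : srt L) (a : M1 (Some s)),
    gact (x : M2 None) (j (Some s) a) = j (Some s) (sigma s a).

(* [rho] is the map sending the class of [sigma] to the class of [x], for any
   [x] in [Hstab] restricting to [sigma]. *)
Definition is_rho
    (rho : quot (AutfL K (reduct M1)) -> quot (G000top K' (emb_comp i j))) :=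
  forall sigma : aut (reduct M1),
    (exists x, Hstab x /\ restricts_to x sigma) /\
    forall x, Hstab x -> restricts_to x sigma ->
      rho (\pi_(quot _) sigma) = \pi_(quot _) x.

End Rho.

(* Main.v *)
(* (1) By Ryll-Nardzewski, the Aut(M)-orbits of tuples of M are 0-definable, so
   an automorphism of M** agrees on any small set with some element of G**.

   (2) mu is the pointwise stabilizer of M in G**.  If A is a normal subgroup
   containing mu, and t is an automorphism of M** (with its group) fixing M, then
   t(x) lies in xA: by (1) choose y in G** agreeing with t on M and x(M); then y
   and t(x)^-1 y x fix M.  Realizing tp(x/M) in M*, every coset of A meets the
   image of G*, so A has bounded index and is invariant.  Hence G000top is just
   the normal closure of mu, and surjectivity of rho follows.

   (3) An element of G** fixing a countable submodel is, by categoricity and (1),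
   conjugate into mu, which makes rho well defined.  Conversely, the elements x
   of G** such that, over any countable set of parameters containing M, the type
   of x is realized in M* by an element acting as a Lascar strong automorphism
   form a normal subgroup containing mu, hence contain G000top; this gives
   injectivity. *)

Require Import Defs.
From Stdlib Require List.
From HB Require Import structures.
From mathcomp Require Import all_boot.
From mathcomp Require Import boolp classical_sets functions cardinality.

Set Implicit Arguments.
Unset Strict Implicit.
Unset Printing Implicit Defensive.

Local Open Scope classical_set_scope.
Local Open Scope card_scope.
Local Open Scope quotient_scope.

(** * Syntax *)

(** Categoricity is given as uniqueness of the countable model, while definable orbits are what is
    needed; so the required part of Ryll-Nardzewski is proved here, in a weak form: every finite
    tuple is part of a longer one whose orbit is definable. Enlarging tuples is harmless, since a
    group element is only asked to agree with an automorphism on them, and it avoids any analysis of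
    all types. The language of the expansion has a symbol for every open set and can be uncountable.
    Categoricity and Löwenheim-Skolem are therefore applied to reducts only; the expansion is
    handled by saturation and homogeneity. An element of [G000top] need not preserve [M1], so one
    cannot ask directly whether it acts there as a Lascar strong automorphism. This is why
    injectivity goes through realizations of its type in [M1]. Parameters are added during the
    realization because a product has to be realized one factor at a time, the second over the
    first. *)

Lemma existT_injr (A : Type) (B : A -> Type) a (x y : B a) :
  existT B a x = existT B a y -> x = y.
Proof.
move=> e; have : projT1_eq e = erefl by exact: Prop_irrelevance.
by have := projT2_eq e => /[swap] -> /=.
Qed.

(** Carriers have no decidable equality, so finite sets are traded for lists with [List.In]. *)
Lemma finite_set_In (T : Type) (A : set T) :
  finite_set A -> exists l : seq T, forall x, A x <-> List.In x l.
Proof.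
pose B : set {classic T} := A.
move=> finA; have /finite_seqP[s Bs] : finite_set B by [].
exists s => x; have -> : A x = [set` s] x by rewrite -Bs.
rewrite /=; elim: s {Bs} => //= y s IH; rewrite in_cons; split.
  by case/orP => [/eqP->|/IH]; [left|right].
by case=> [->|/IH ->]; rewrite ?eqxx ?orbT.
Qed.

Lemma small_le (K T U : Type) (A : set T) (B : set U) :
  small K B -> A #<= B -> small K A.
Proof.
move=> [BK nKB] AB; split; first exact: card_le_trans AB BK.
by move=> KA; apply: nKB; exact: card_le_trans KA AB.
Qed.

Section Syntax.
Variable L : lang.
Local Notation S := (srt L).

Fixpoint tsubst n (g : idx n -> S) s (t : term g s) m (g' : idx m -> S)
    (r : forall i, term g' (g i)) : term g' s :=
  match t with
  | Var i => r i
  | App f a => App (fun i => tsubst (a i) r)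
  end.

Definition wk n (g : idx n -> S) s0 s (t : term g s) : term (scons s0 g) s :=
  tsubst t (fun i => Var (scons s0 g) (Some i)).

Definition slift n (g : idx n -> S) m (g' : idx m -> S)
    (r : forall i, term g' (g i)) s : forall i, term (scons s g') (scons s g i) :=
  fun i => match i with
           | Some j => wk s (r j)
           | None => Var (scons s g') None
           end.

Fixpoint fsubst n (g : idx n -> S) (p : form g) :
    forall m (g' : idx m -> S), (forall i, term g' (g i)) -> form g' :=
  match p with
  | Bot _ _ => fun _ g' _ => Bot g'
  | Eq _ _ _ t u => fun _ _ r => Eq (tsubst t r) (tsubst u r)
  | Rel _ _ _ a => fun _ _ r => Rel (fun i => tsubst (a i) r)
  | Imp _ _ p q => fun _ _ r => Imp (fsubst p r) (fsubst q r)
  | All _ _ s p => fun _ _ r => All (fsubst p (slift r s))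
  end.

Lemma eval_tsubst (M : structure L) n (g : idx n -> S) s (t : term g s) m
    (g' : idx m -> S) (r : forall i, term g' (g i)) (v : forall i, M (g' i)) :
  eval v (tsubst t r) = eval (fun i => eval v (r i)) t.
Proof.
elim: t => //= f a IH; congr funI; exact: functional_extensionality_dep.
Qed.

Lemma eval_wk (M : structure L) n (g : idx n -> S) s0 s (t : term g s)
    (x : M s0) (v : forall i, M (g i)) :
  eval (vcons x v) (wk s0 t) = eval v t.
Proof. by rewrite eval_tsubst. Qed.

Lemma eval_slift (M : structure L) n (g : idx n -> S) m (g' : idx m -> S)
    (r : forall i, term g' (g i)) s (x : M s) (v : forall i, M (g' i)) :
  (fun i => eval (vcons x v) (slift r s i)) = vcons x (fun i => eval v (r i)).
Proof.
by apply: functional_extensionality_dep; case=> //= j; rewrite eval_wk.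
Qed.

Lemma sat_fsubst (M : structure L) n (g : idx n -> S) (p : form g) m
    (g' : idx m -> S) (r : forall i, term g' (g i)) (v : forall i, M (g' i)) :
  sat (fsubst p r) v <-> sat p (fun i => eval v (r i)).
Proof.
elim: p m g' r v => {n g} /= [n g|n g s t u|n g R a|n g p IHp q IHq|n g s p IH]
  m g' r v.
- by [].
- by rewrite !eval_tsubst.
- suff -> : (fun i => eval v (tsubst (a i) r)) =
            (fun i => eval (fun j => eval v (r j)) (a i)) by [].
  by apply: functional_extensionality_dep => i; rewrite eval_tsubst.
- by split=> h /IHp/h/IHq.
- by split=> h x; move: (h x); rewrite IH eval_slift.
Qed.

Definition fwk n (g : idx n -> S) s (p : form g) : form (scons s g) :=
  fsubst p (fun i => Var (scons s g) (Some i)).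

Lemma sat_fwk (M : structure L) n (g : idx n -> S) s (p : form g)
    (v : forall i, M (scons s g i)) :
  sat (fwk s p) v <-> sat p (fun i => v (Some i)).
Proof. exact: sat_fsubst. Qed.

Definition Not n (g : idx n -> S) (p : form g) := Imp p (Bot g).
Definition And n (g : idx n -> S) (p q : form g) := Not (Imp p (Not q)).
Definition Ex n (g : idx n -> S) s (p : form (scons s g)) := Not (All (Not p)).

Lemma sat_And (M : structure L) n (g : idx n -> S) (p q : form g)
    (v : forall i, M (g i)) : sat (And p q) v <-> sat p v /\ sat q v.
Proof.
split=> [/=|[hp hq] /= h]; last exact: h.
by case: (EM (sat p v)) (EM (sat q v)) => hp [] hq; tauto.
Qed.

Lemma sat_Ex (M : structure L) n (g : idx n -> S) s (p : form (scons s g))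
    (v : forall i, M (g i)) : sat (Ex p) v <-> exists x, sat p (vcons x v).
Proof. by split=> [/= h|[x hx] /= /(_ x)]//; apply: contrapT => /forallNP. Qed.

Lemma vconsE (M : structure L) n (g : idx n -> S) s (v : forall i, M (scons s g i)) :
  v = vcons (v None) (fun i => v (Some i)).
Proof. by apply: functional_extensionality_dep; case. Qed.

Lemma sconsE n (g : idx n.+1 -> S) : g = scons (g None) (fun i => g (Some i)).
Proof. by apply: functional_extensionality_dep; case. Qed.

Lemma bigand n (g : idx n -> S) m (P : idx m -> form g) :
  exists q : form g, forall (M : structure L) (v : forall i, M (g i)),
    sat q v <-> forall i, sat (P i) v.
Proof.
elim: m P => [|m IH] P; first by exists (Not (Bot g)) => M v; split=> // _ [].
have [q qP] := IH (fun i => P (Some i)).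
exists (And (P None) q) => M v; rewrite sat_And qP; split.
  by case=> h h' [].
by move=> h; split=> // i; exact: h.
Qed.

Fixpoint catc n m : (idx n -> S) -> (idx m -> S) -> idx (n + m) -> S :=
  match n with
  | 0 => fun _ g2 => g2
  | n.+1 => fun g1 g2 => scons (g1 None) (catc (fun i => g1 (Some i)) g2)
  end.

Fixpoint catv (M : structure L) n m : forall (g1 : idx n -> S) (g2 : idx m -> S),
    (forall i, M (g1 i)) -> (forall i, M (g2 i)) -> forall i, M (catc g1 g2 i) :=
  match n with
  | 0 => fun _ _ _ v2 => v2
  | n.+1 => fun g1 g2 v1 v2 => vcons (v1 None) (catv (fun i => v1 (Some i)) v2)
  end.

(** A term rather than an index: at the corresponding index [catc g1 g2] equals [g1 i] only
    propositionally, whereas a term carries its sort and needs no transport. *)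
Fixpoint catl n m : forall (g1 : idx n -> S) (g2 : idx m -> S) (i : idx n),
    term (catc g1 g2) (g1 i) :=
  match n with
  | 0 => fun _ _ i => match i with end
  | n.+1 => fun g1 g2 i =>
      match i with
      | None => Var (scons (g1 None) (catc (fun i => g1 (Some i)) g2)) None
      | Some j => wk (g1 None) (catl (fun i => g1 (Some i)) g2 j)
      end
  end.

Fixpoint catr n m : forall (g1 : idx n -> S) (g2 : idx m -> S) (i : idx m),
    term (catc g1 g2) (g2 i) :=
  match n with
  | 0 => fun _ g2 i => Var g2 i
  | n.+1 => fun g1 g2 i => wk (g1 None) (catr (fun i => g1 (Some i)) g2 i)
  end.

Lemma eval_catl (M : structure L) n m (g1 : idx n -> S) (g2 : idx m -> S)
    (v1 : forall i, M (g1 i)) (v2 : forall i, M (g2 i)) i :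
  eval (catv v1 v2) (catl g1 g2 i) = v1 i.
Proof.
elim: n g1 v1 i => [|n IH] g1 v1; first by case.
by case=> [j|] //=; rewrite eval_wk IH.
Qed.

Lemma eval_catr (M : structure L) n m (g1 : idx n -> S) (g2 : idx m -> S)
    (v1 : forall i, M (g1 i)) (v2 : forall i, M (g2 i)) i :
  eval (catv v1 v2) (catr g1 g2 i) = v2 i.
Proof. by elim: n g1 v1 => [|n IH] g1 v1 //=; rewrite eval_wk IH. Qed.

(** Universal closure, one variable at a time, leaves a sentence to be preserved. The laws of the
    action pass from [M] to its extensions in this way. *)
Lemma elem_all (M N : structure L) (e : elem_emb M N) n (g : idx n -> S)
    (p : form g) :
  (forall v : forall i, M (g i), sat p v) ->
  forall v : forall i, N (g i), sat p v.
Proof.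
elim: n g p => [|n IH] g p h v.
  pose w : forall i, M (g i) := fun i : void => match i with end.
  have := (emb_elem e p w).1 (h w).
  by congr sat; apply: functional_extensionality_dep => -[].
move: p h v; rewrite (sconsE g) => p h v.
have := IH _ (All p) _ (fun i => v (Some i)) => /= H.
by rewrite (vconsE v); apply: H => w x; exact: h.
Qed.

Lemma elem_equiv_emb (M N : structure L) (e : elem_emb M N) : elem_equiv M N.
Proof.
move=> p; apply: (iff_trans (emb_elem e p _)).
suff -> : (fun i => e _ (nilv M i)) = nilv N by [].
by apply: functional_extensionality_dep => -[].
Qed.

End Syntax.

(** * Partial elementary maps *)

Arguments pf_ctx {L M s} p i.
Arguments pf_val {L M s} p i.

Section Pelem.
Variables (L : lang) (P N : structure L).
Local Notation S := (srt L).
Implicit Types R : forall s, P s -> N s -> Prop.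

(** Elementary maps are relations, so that they can be restricted, extended and composed without
    describing a domain. That they are functional and injective is a consequence ([pelem_inj]). *)
Definition pelem R :=
  forall n (g : idx n -> S) (p : form g) (v : forall i, P (g i))
    (w : forall i, N (g i)), (forall i, R _ (v i) (w i)) -> sat p v <-> sat p w.

Definition ran R : set (elt N) :=
  [set y | exists a, R (projT1 y) a (projT2 y)].

Inductive add1 R s (c : P s) (x : N s) : forall s', P s' -> N s' -> Prop :=
| AddOld s' a b : R s' a b -> add1 R c x a b
| AddNew : add1 R c x c x.

Lemma pelem_sub R R' :
  (forall s a b, R s a b -> R' s a b) -> pelem R' -> pelem R.
Proof. by move=> sub h n g p v w vw; apply: h => i; exact: sub. Qed.

Lemma matched_cat R n m (g1 : idx n -> S) (g2 : idx m -> S)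
    (v1 : forall i, P (g1 i)) (v2 : forall i, P (g2 i))
    (w1 : forall i, N (g1 i)) (w2 : forall i, N (g2 i)) :
  (forall i, R _ (v1 i) (w1 i)) -> (forall i, R _ (v2 i) (w2 i)) ->
  forall i, R _ (catv v1 v2 i) (catv w1 w2 i).
Proof.
elim: n g1 v1 w1 => [//|n IH] g1 v1 w1 h1 h2.
by case=> [j|]; [apply: IH h2 j => i; exact: h1|exact: h1].
Qed.

(** The new pair may occur in a matched tuple at several places or at none. Writing the tuple as
    terms in one variable for the new pair and other variables matched by [R] turns a formula about
    it into a formula with one distinguished variable, as in a one-variable type. *)
Lemma add1_terms R s (c : P s) (x : N s) n (g : idx n -> S)
    (v : forall i, P (g i)) (w : forall i, N (g i)) :
  (forall i, add1 R c x (v i) (w i)) ->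
  exists m (g' : idx m -> S) (v' : forall i, P (g' i)) (w' : forall i, N (g' i))
    (r : forall i, term (scons s g') (g i)),
    [/\ forall i, R _ (v' i) (w' i),
        forall i, eval (vcons c v') (r i) = v i &
        forall i, eval (vcons x w') (r i) = w i].
Proof.
elim: n g v w => [|n IH] g v w vw.
  exists 0, (@nilc S), (@nilv L P), (@nilv L N).
  by exists (fun i : void => match i with end); split=> -[].
have [m [g' [v' [w' [r [vw' rv rw]]]]]] := IH _ _ _ (fun i => vw (Some i)).
suff [m1 [g1 [v1 [w1 [t [r' [h1 [h2 h3] h4]]]]]]] :
    exists m1 (g1 : idx m1 -> S) (v1 : forall i, P (g1 i))
      (w1 : forall i, N (g1 i)) (t : term (scons s g1) (g None))
      (r' : forall i, term (scons s g1) (g (Some i))),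
      [/\ forall i, R _ (v1 i) (w1 i),
          eval (vcons c v1) t = v None /\ eval (vcons x w1) t = w None &
          forall i, eval (vcons c v1) (r' i) = v (Some i) /\
                    eval (vcons x w1) (r' i) = w (Some i)].
  exists m1, g1, v1, w1, (fun i => match i with Some j => r' j | None => t end).
  by split=> // -[j|] //; case: (h4 j).
case: (vw None) => [s' a b Rab|].
  pose up : forall i, term (scons s (scons s' g')) (scons s g' i) := fun i =>
    match i with
    | Some j => Var (scons s (scons s' g')) (Some (Some j))
    | None => Var (scons s (scons s' g')) None
    end.
  have ev (Q : structure L) (y : Q s) (z : Q s') u :
      (fun i => eval (vcons y (vcons z u)) (up i)) = vcons y u.
    by apply: functional_extensionality_dep; case.
  exists m.+1, (scons s' g'), (vcons a v'), (vcons b w').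
  exists (Var (scons s (scons s' g')) (Some None)), (fun i => tsubst (r i) up).
  by split=> [[]//||i]; last by rewrite !eval_tsubst !ev.
by exists m, g', v', w', (Var (scons s g') None), r.
Qed.

Lemma pelem_ext K R s (c : P s) :
  saturated K N -> pelem R -> small K (ran R) ->
  exists x : N s, pelem (add1 R c x).
Proof.
move=> satN eR sR.
(* The type of [c] over the domain of [R], with each parameter replaced by its image. *)
pose T : set (pform N s) := [set q | exists v : forall i, P (pf_ctx q i),
  (forall i, R _ (v i) (pf_val q i)) /\ sat (pf_form q) (vcons c v)].
(* Finitely many members of [T] are merged into one formula over concatenated parameters; that they
   have a common solution is then the single statement [Ex p], which [R] preserves. *)
have fin (l : seq (pform N s)) : (forall q, List.In q l -> T q) ->
    exists n (g : idx n -> S) (p : form (scons s g)) (v : forall i, P (g i))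
      (w : forall i, N (g i)),
      [/\ forall i, R _ (v i) (w i), sat p (vcons c v) &
          forall x, sat p (vcons x w) -> forall q, List.In q l -> psat q x].
  elim: l => [|q l IH] h.
    exists 0, (@nilc S), (Not (Bot _)), (@nilv L P), (@nilv L N).
    by split=> // -[].
  have [n [g [p [v [w [vw pv pw]]]]]] := IH (fun q' q'l => h q' (or_intror q'l)).
  have [u [uq qu]] := h q (or_introl erefl).
  pose r1 := slift (fun i => catl g (pf_ctx q) i) s.
  pose r2 := slift (fun i => catr g (pf_ctx q) i) s.
  have e1 (Q : structure L) (y : Q s) a b :
      (fun i => eval (vcons y (catv a b)) (r1 i)) = vcons y a.
    rewrite eval_slift; congr vcons; apply: functional_extensionality_dep => i.
    exact: eval_catl.
  have e2 (Q : structure L) (y : Q s) a b :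
      (fun i => eval (vcons y (catv a b)) (r2 i)) = vcons y b.
    rewrite eval_slift; congr vcons; apply: functional_extensionality_dep => i.
    exact: eval_catr.
  exists (n + pf_n q), (catc g (pf_ctx q)).
  exists (And (fsubst p r1) (fsubst (pf_form q) r2)).
  exists (catv v u), (catv w (pf_val q)); split.
  - exact: matched_cat.
  - by rewrite sat_And !sat_fsubst e1 e2.
  - move=> x; rewrite sat_And !sat_fsubst e1 e2 => -[/pw h1 h2] q' [<-//|].
    exact: h1.
have [] := satN (ran R) s T sR.
- move=> q [v [vq _]] _ [i _ <-]; exists (v i); exact: vq.
- move=> F /finite_set_In[l Fl] FT.
  have [|n [g [p [v [w [vw pv pw]]]]]] := fin l; first by move=> q /Fl/FT.
  have /sat_Ex[x hx] : sat (Ex p) w.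
    by apply/(eR _ _ _ v w vw); apply/sat_Ex; exists c.
  by exists x => q /Fl; exact: pw.
move=> x Tx; exists x => n g p v w vw.
have [m [g' [v' [w' [r [vw' rv rw]]]]]] := add1_terms vw.
have one (q : form g) : sat q v -> sat q w.
  have -> : v = fun i => eval (vcons c v') (r i).
    by apply: functional_extensionality_dep => i; rewrite rv.
  have -> : w = fun i => eval (vcons x w') (r i).
    by apply: functional_extensionality_dep => i; rewrite rw.
  rewrite -!sat_fsubst => qv.
  by have := Tx (PForm (fsubst q r) w'); apply; exists v'.
by split; [exact: one|move=> pw; apply: contrapT => /(one (Not p)) /(_ pw)].
Qed.

Lemma pelem_inj R : pelem R ->
  forall s a a' b b', R s a b -> R s a' b' -> a = a' <-> b = b'.
Proof.
move=> eR s a a' b b' h h'.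
pose g : idx 2 -> S := scons s (scons s (@nilc S)).
have := eR _ _ (Eq (Var g None) (Var g (Some None)))
  (vcons a (vcons a' (@nilv L P))) (vcons b (vcons b' (@nilv L N))).
by apply; case=> [[[]|]|].
Qed.

Lemma pelem_emb (e : elem_emb P N) : pelem (fun s a b => b = e s a).
Proof.
move=> n g p v w vw; have -> : w = fun i => e _ (v i).
  exact: functional_extensionality_dep.
exact: emb_elem.
Qed.

End Pelem.

Lemma pelem_span (L : lang) (Q P N : structure L) (e : elem_emb Q P)
    (e' : elem_emb Q N) :
  pelem (fun s a b => exists c, a = e s c /\ b = e' s c).
Proof.
move=> n g p v w H; pose c i := projT1 (cid (H i)).
have -> : v = fun i => e _ (c i).
  by apply: functional_extensionality_dep => i; case: (projT2 (cid (H i))).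
have -> : w = fun i => e' _ (c i).
  by apply: functional_extensionality_dep => i; case: (projT2 (cid (H i))).
by rewrite -!emb_elem.
Qed.

Lemma pelem_post (L : lang) (P N Q : structure L)
    (R : forall s, P s -> N s -> Prop) (e : elem_emb N Q) :
  pelem R -> pelem (fun s a b => exists c, R s a c /\ b = e s c).
Proof.
move=> eR n g p v w H; pose c i := projT1 (cid (H i)).
have -> : w = fun i => e _ (c i).
  by apply: functional_extensionality_dep => i; case: (projT2 (cid (H i))).
by rewrite -emb_elem; apply: eR => i; case: (projT2 (cid (H i))).
Qed.

(** Elementary maps preserve the equation between a variable and a term. This identifies an element
    that saturation produces only up to its type. *)
Lemma pelem_term (L : lang) (P N : structure L) (R : forall s, P s -> N s -> Prop)
    n (g : idx n -> srt L) (v : forall i, P (g i)) (w : forall i, N (g i)) s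
    (t : term g s) d :
  pelem R -> (forall i, R _ (v i) (w i)) -> R s (eval v t) d -> d = eval w t.
Proof.
move=> eR vw td.
have := eR _ _ (Eq (Var (scons s g) None) (wk s t)) (vcons (eval v t) v) (vcons d w).
by rewrite /= !eval_wk => H; apply H => // -[].
Qed.

Arguments pelem_emb {L P N} e.
Arguments pelem_span {L Q P N} e e'.
Arguments pelem_post {L P N Q R} e.

Definition dom (L : lang) (P N : structure L) (R : forall s, P s -> N s -> Prop) :
  set (elt P) := [set x | exists b, R (projT1 x) (projT2 x) b].

Lemma pelem_hom K (L : lang) (N : structure L) (R : forall s, N s -> N s -> Prop) :
  strongly_homogeneous K N -> pelem R -> small K (dom R) ->
  exists h : aut N, forall s a b, R s a b -> h s a = b.
Proof.
move=> homN eR sR.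
(* Strong homogeneity is stated for total functions, so [R] is completed by the identity outside its
   domain. *)
have H (x : elt N) : exists b : N (projT1 x),
    (exists b', R _ (projT2 x) b') -> R _ (projT2 x) b.
  by case: (EM (exists b', R _ (projT2 x) b')) => [[b h]|h];
    [exists b|exists (projT2 x)].
pose f x := projT1 (cid (H x)); have fP x : _ := projT2 (cid (H x)).
have [|h hP] := homN (dom R) (fun s a => f (existT _ s a)) sR.
  move=> n g p v vR; apply: eR => i.
  have hi : dom R (existT _ (g i) (v i)) by apply: vR; exists i.
  exact: fP hi.
exists h => s a b Rab.
have Da : dom R (existT _ s a) by exists b.
rewrite hP //; have Rf := fP _ Da.
exact/esym/(pelem_inj eR Rab Rf).
Qed.

(** * Countable elementary submodels *)

Fixpoint idxnat n : idx n -> nat :=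
  match n with
  | 0 => fun i : void => match i with end
  | n.+1 => fun i : idx n.+1 => if i is Some j then (idxnat j).+1 else 0
  end.

Lemma idxnat_inj n : injective (@idxnat n).
Proof.
by elim: n => [|n IH] [] // => [a [b [/IH->]|]|[]].
Qed.

Fixpoint idxseq (T : Type) n : (idx n -> T) -> seq T :=
  match n with
  | 0 => fun=> [::]
  | n.+1 => fun F => F None :: idxseq (fun i => F (Some i))
  end.

Lemma idxseq_inj (T : Type) n (F G : idx n -> T) :
  idxseq F = idxseq G -> forall i, F i = G i.
Proof.
elim: n F G => [|n IH] F G; first by move=> _ [].
by move=> [h /IH h'] [i|//]; exact: h'.
Qed.

Lemma In_idxseq (T : Type) n (F : idx n -> T) x :
  List.In x (idxseq F) <-> exists i, F i = x.
Proof.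
elim: n F => [|n IH] F /=; first by split=> // -[[]].
rewrite IH; split=> [[h|[i h]]|[[i|] h]]; [by exists None|by exists (Some i)| |by left].
by right; exists i.
Qed.

Lemma countable_inj (T : Type) :
  countable [set: T] -> exists f : T -> nat, injective f.
Proof. by move=> /countable_injP[f fI]; exists f => x y; apply: fI; rewrite inE. Qed.

Lemma inj_countable (T : Type) (U : countType) (f : T -> U) :
  injective f -> countable [set: T].
Proof.
move=> fI; apply/countable_injP; exists (pickle \o f) => x y _ _ /=.
by move=> /(pcan_inj pickleK)/fI.
Qed.

Lemma countableU (T : Type) (A B : set T) :
  countable A -> countable B -> countable (A `|` B).
Proof.
move=> cA cB; have -> : A `|` B = \bigcup_(b in [set: bool]) (if b then A else B).
  apply/seteqP; split=> x; first by case=> h; [exists true|exists false].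
  by case=> -[] _ h; [left|right].
by apply: bigcup_countable => [|[]//]; exact: countableP.
Qed.

Lemma countable_enum (T : Type) :
  countable [set: T] -> exists e : nat -> option T, forall x, exists k, e k = Some x.
Proof.
move=> /countable_inj[f fI].
have /choice[e eP] (k : nat) : exists o : option T, forall x, f x = k -> o = Some x.
  case: (EM (exists x, f x = k)) => [[x <-]|h].
    by exists (Some x) => y /fI->.
  by exists None => x hx; case: h; exists x.
by exists e => x; exists (f x); exact: eP.
Qed.

Lemma countable_tuples n (T : idx n -> Type) :
  (forall i, countable [set: T i]) -> countable [set: forall i, T i].
Proof.
move=> cT; have H i := countable_inj (cT i).
pose f i := projT1 (cid (H i)); have fI i : injective (f i) := projT2 (cid (H i)).
apply: (@inj_countable _ (seq nat : countType) (fun v => idxseq (fun i => f i (v i)))).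
move=> v w /idxseq_inj h; apply: functional_extensionality_dep => i.
exact/fI/h.
Qed.

(** * Countability of the set of formulas *)

Section Codes.
Variable L : lang.
Local Notation S := (srt L).
Hypotheses (cS : countable [set: S]) (cF : countable [set: Defs.fsym L])
  (cR : countable [set: rsym L]).

Section Injections.
Variables (cs : S -> nat) (cf : Defs.fsym L -> nat) (cr : rsym L -> nat).
Hypotheses (csI : injective cs) (cfI : injective cf) (crI : injective cr).

Fixpoint cdt n (g : idx n -> S) s (t : term g s) : GenTree.tree nat :=
  match t with
  | Var i => GenTree.Leaf (idxnat i)
  | App f a => GenTree.Node (cf f) (idxseq (fun i => cdt (a i)))
  end.

(** Labels 0, 1 and 2 belong to equality, implication and quantification, so relation symbols start
    at 3. Contexts are not coded; only formulas in the same context are compared. *)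
Fixpoint cdf n (g : idx n -> S) (p : form g) : GenTree.tree nat :=
  match p with
  | Bot _ _ => GenTree.Leaf 0
  | Eq _ _ _ t u => GenTree.Node 0 [:: cdt t; cdt u]
  | Rel _ _ r a => GenTree.Node (cr r).+3 (idxseq (fun i => cdt (a i)))
  | Imp _ _ p q => GenTree.Node 1 [:: cdf p; cdf q]
  | All _ _ s p => GenTree.Node 2 [:: GenTree.Leaf (cs s); cdf p]
  end.

Lemma cdt_inj n (g : idx n -> S) s (t : term g s) s' (t' : term g s') :
  cdt t = cdt t' -> existT (term g) s t = existT (term g) s' t'.
Proof.
elim: t s' t' => [i|f a IH] s' [i'|f' a'] //=; first by case=> /idxnat_inj->.
case=> /cfI ff'; subst f' => /idxseq_inj h; congr existT; congr App.
apply: functional_extensionality_dep => i. exact/existT_injr/IH/h.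
Qed.

Lemma cdf_inj n (g : idx n -> S) (p : form g) n' (g' : idx n' -> S)
    (p' : form g') :
  existT (fun n => idx n -> S) n g = existT _ n' g' -> cdf p = cdf p' ->
  existT (fun c : {n & idx n -> S} => form (projT2 c)) (existT _ n g) p =
  existT _ (existT _ n' g') p'.
Proof.
elim: p n' g' p' => {n g} [n g|n g s t u|n g r a|n g p IHp q IHq|n g s p IH]
  n' g' p' e; case: p' e => {n' g'}
  [n' g'|n' g' s' t' u'|n' g' r' a'|n' g' p' q'|n' g' s' p'] e //=.
- by have e1 := existT_inj1 e; subst n'; rewrite (existT_injr e).
- have e1 := existT_inj1 e; subst n'; have {}e := existT_injr e; subst g'.
  case=> /cdt_inj h /cdt_inj h'.
  have e1 := existT_inj1 h; subst s'.
  by rewrite (existT_injr h) (existT_injr h').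
- have e1 := existT_inj1 e; subst n'; have {}e := existT_injr e; subst g'.
  case=> /crI e1; subst r' => /idxseq_inj h; congr existT; congr Rel.
  apply: functional_extensionality_dep => i; exact/existT_injr/cdt_inj/h.
- have e1 := existT_inj1 e; subst n'; have {}e := existT_injr e; subst g'.
  case=> /(IHp _ _ _ erefl) h /(IHq _ _ _ erefl) h'.
  have -> : p = p' by exact: existT_injr h.
  by have -> : q = q' by exact: existT_injr h'.
- have e1 := existT_inj1 e; subst n'; have {}e := existT_injr e; subst g'.
  case=> /csI e1; subst s' => /(IH _ _ _ erefl) h.
  by have -> : p = p' by exact: existT_injr h.
Qed.
End Injections.

Lemma countable_form n (g : idx n -> S) : countable [set: form g].
Proof.
have [cs csI] := countable_inj cS; have [cf cfI] := countable_inj cF.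
have [cr crI] := countable_inj cR.
apply: (@inj_countable _ (GenTree.tree nat : countType) (@cdf cs cf cr n g)).
move=> p q h; exact: existT_injr (cdf_inj csI cfI crI erefl h).
Qed.

End Codes.

(** Iterated negations of [Bot] are told apart by their nesting depth. Through this bound [large]
    makes every countable set small. *)
Lemma nat_le_formula (L : lang) : [set: nat] #<= [set: formula L].
Proof.
pose F := fix F n : form (@nilc (srt L)) :=
  if n is m.+1 then Imp (F m) (Bot _) else Bot _.
pose dep := fix dep n (g : idx n -> srt L) (p : form g) : nat :=
  match p with Imp _ _ p _ => (dep _ _ p).+1 | _ => 0 end.
have FK n : dep _ _ (F n) = n by elim: n => //= n ->.
have : [set: nat] `<=` (fun q : formula L => dep _ _ (projT2 (projT2 q))) @` [set: formula L].
  move=> n _; exists (existT _ 0 (existT _ _ (F n))) => //=; exact: FK.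
move=> /subset_card_le h; apply: card_le_trans h _; exact: card_image_le.
Qed.

(** The closure is the set of values of finite trees labelled by numbers: leaves name elements of
    [A0], nodes apply operations, and there are countably many trees. *)
Lemma countable_closure (T : Type) (x0 : T) (A0 : set T) (op : nat -> seq T -> T) :
  countable A0 -> exists A : set T, [/\ countable A, A0 `<=` A &
    forall k l, (forall x, List.In x l -> A x) -> A (op k l)].
Proof.
move=> /countable_injP[f fI].
have /choice[lf lfP] (k : nat) : exists x, forall y, A0 y -> f y = k -> x = y.
  case: (EM (exists2 y, A0 y & f y = k)) => [[y Ay <-]|h].
    by exists y => z Az /esym/fI; rewrite !inE; apply.
  by exists x0 => y Ay yk; case: h; exists y.
pose ev := fix ev (t : GenTree.tree nat) : T := match t with
  | GenTree.Leaf k => lf k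
  | GenTree.Node k ts => op k (map ev ts)
  end.
exists (range ev); split.
- apply: sub_countable (card_image_le _ _) _; exact: countableP.
- move=> y Ay; exists (GenTree.Leaf (f y)) => //=; exact: lfP.
- move=> k l hl; suff [ts <-] : exists ts, map ev ts = l.
    by exists (GenTree.Node k ts).
  elim: l hl => [|x l IH] hl; first by exists [::].
  have [ts <-] := IH (fun y yl => hl y (or_intror yl)).
  by have [t _ <-] := hl x (or_introl erefl); exists (t :: ts).
Qed.

(** * Lists as valuations, and the Tarski-Vaught test *)

Section Lists.
Variables (L : lang) (N : structure L).
Local Notation S := (srt L).

Fixpoint lctx (l : seq (elt N)) : idx (size l) -> S :=
  match l return idx (size l) -> S with
  | [::] => @nilc S
  | x :: l => scons (projT1 x) (@lctx l)
  end.
Arguments lctx l i : clear implicits.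

Fixpoint lval (l : seq (elt N)) : forall i, N (lctx l i) :=
  match l return forall i, N (lctx l i) with
  | [::] => @nilv L N
  | x :: l => vcons (projT2 x) (@lval l)
  end.
Arguments lval l i : clear implicits.

Lemma lval_In (l : seq (elt N)) i : List.In (existT _ (lctx l i) (lval l i)) l.
Proof.
elim: l i => [[]|[s x] l IH [i|]]; [right; exact: IH|by left].
Qed.

Lemma In_lval (l : seq (elt N)) x :
  List.In x l -> exists i, existT _ (lctx l i) (lval l i) = x.
Proof.
elim: l => //= y l IH [<-|/IH[i <-]]; last by exists (Some i).
by exists None; case: y.
Qed.

Lemma list_term (l : seq (elt N)) x : List.In x l ->
  exists t : term (lctx l) (projT1 x), eval (lval l) t = projT2 x.
Proof.
by move=> /In_lval[i <-]; exists (Var (lctx l) i).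
Qed.

Lemma list_terms (l : seq (elt N)) n (g : idx n -> S) (v : forall i, N (g i)) :
  (forall i, List.In (existT _ (g i) (v i)) l) ->
  exists r : forall i, term (lctx l) (g i), (fun i => eval (lval l) (r i)) = v.
Proof.
move=> vl; have H i := list_term (vl i).
exists (fun i => projT1 (cid (H i))); apply: functional_extensionality_dep => i.
exact: projT2 (cid (H i)).
Qed.

Definition tv (A : set (elt N)) :=
  forall l, (forall x, List.In x l -> A x) ->
  forall s (p : form (scons s (lctx l))), (exists x, sat p (vcons x (lval l))) ->
  exists2 x, A (existT _ s x) & sat p (vcons x (lval l)).

Lemma tv_tuple (A : set (elt N)) l n (g : idx n -> S) (v : forall i, N (g i)) :
  (forall i, List.In (existT _ (g i) (v i)) l) ->
  (forall s (p : form (scons s (lctx l))), (exists x, sat p (vcons x (lval l))) ->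
    exists2 x, A (existT _ s x) & sat p (vcons x (lval l))) ->
  forall s (p : form (scons s g)), (exists x, sat p (vcons x v)) ->
  exists2 x, A (existT _ s x) & sat p (vcons x v).
Proof.
move=> vl tvA s p; have [r <-] := list_terms vl.
have E x : sat (fsubst p (slift r s)) (vcons x (lval l)) <->
           sat p (vcons x (fun i => eval (lval l) (r i))).
  by rewrite sat_fsubst eval_slift.
case=> x /E px; have [|y Ay /E py] := tvA s (fsubst p (slift r s)).
  by exists x.
by exists y.
Qed.

Lemma tv_substructure (A : set (elt N)) : tv A ->
  exists (N0 : structure L) (e : elem_emb N0 N),
    (forall s x, A (existT _ s x) <-> exists y, e s y = x) /\
    (countable A -> countable_structure N0).
Proof.
move=> tvA.
have tvg n (g : idx n -> S) (v : forall i, N (g i)) :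
    (forall i, A (existT _ (g i) (v i))) ->
    forall s (p : form (scons s g)), (exists x, sat p (vcons x v)) ->
    exists2 x, A (existT _ s x) & sat p (vcons x v).
  move=> vA; pose l := idxseq (fun i => existT N (g i) (v i)).
  apply: (@tv_tuple A l) => [i|]; first by apply/In_idxseq; exists i.
  by apply: tvA => x /In_idxseq[i <-].
pose car s := {x : N s | A (existT _ s x)}.
(* The test applied to the formula saying that a variable equals the value of [f] puts that value in
   [A]. *)
have fA (f : Defs.fsym L) (v : forall i, car (@fdom L f i)) :
    A (existT _ (fcod f) (funI N f (fun i => sval (v i)))).
  pose g := scons (fcod f) (@fdom L f).
  have [|x Ax /= <-//] := tvg _ _ _ (fun i => svalP (v i)) (fcod f)
    (Eq (Var g None) (App (fun i => Var g (Some i)))).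
  by exists (funI N f (fun i => sval (v i))).
pose N0 := @Structure L car (fun f v => exist _ _ (fA f v))
  (fun r v => relI N r (fun i => sval (v i))).
have svI s (a b : N0 s) : sval a = sval b -> a = b.
  case: a b => a Aa [b Ab] /= ab; subst b; congr exist; exact: Prop_irrelevance.
have ev n (g : idx n -> S) (v : forall i, N0 (g i)) s (t : term g s) :
    sval (eval v t) = eval (fun i => sval (v i)) t.
  elim: t => //= f a IH; congr funI; exact: functional_extensionality_dep.
have el n (g : idx n -> S) (p : form g) (v : forall i, N0 (g i)) :
    sat p v <-> sat p (fun i => sval (v i)).
  elim: p v => {n g} /= [n g|n g s t u|n g r a|n g p IHp q IHq|n g s p IH] v.
  - by [].
  - by rewrite -!ev; split=> [->//|/svI].
  - suff -> : (fun i => sval (@eval L N0 _ _ v _ (a i))) =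
            (fun i => eval (fun j => sval (v j)) (a i)) by [].
    by apply: functional_extensionality_dep.
  - by split=> h /IHp/h/IHq.
  - have E (a : N0 s) : (fun i => sval (@vcons L N0 n g s a v i)) =
                vcons (sval a) (fun i => sval (v i)).
      by apply: functional_extensionality_dep; case.
    split=> h x; last by rewrite IH E.
    apply: contrapT => npx.
    have [|y Ay] := tvg _ _ _ (fun i => svalP (v i)) s (Not p); first by exists x.
    by apply; have := h (exist _ y Ay); rewrite IH E.
exists N0, (@ElemEmb L N0 N (fun s x => sval x) el); split.
  by move=> s x; split=> [Ax|[[y Ay] /= <-//]]; exists (exist _ x Ax).
move=> /countable_injP[f fI]; apply/countable_injP.
exists (fun x : elt N0 => f (existT _ (projT1 x) (sval (projT2 x)))).
move=> [s [x Ax]] [s' [x' Ax']] _ _ /= /fI; rewrite !inE => /(_ Ax Ax') e.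
have e1 := existT_inj1 e; subst s'; have {}e := existT_injr e; subst x'.
by congr existT; congr exist; exact: Prop_irrelevance.
Qed.

End Lists.

Arguments lctx {L N} l i.
Arguments lval {L N} l i.


Definition countable_lang (L : lang) := [/\ countable [set: srt L],
  countable [set: Defs.fsym L] & countable [set: rsym L]].

(** A Skolem function is indexed by the rank of a quantified formula over the context of its
    argument list. The extra operations [op] serve [M_homogeneous], where the submodel must also be
    closed under chosen automorphisms. *)
Lemma lowenheim_skolem (L : lang) (N : structure L) (x0 : elt N)
    (A0 : set (elt N)) (op : nat -> seq (elt N) -> elt N) :
  countable_lang L -> countable A0 ->
  exists A : set (elt N), [/\ countable A, A0 `<=` A, tv A &
    forall k l, (forall x, List.In x l -> A x) -> A (op k l)].
Proof.
move=> [cS cF cR] cA0.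
(* A partial inverse of [All], through which two quantified formulas in one context are compared. *)
pose unAll n (g : idx n -> srt L) (p : form g) :
    option {s & form (scons s g)} :=
  if p is All _ g s q then Some (existT (fun s => form (scons s g)) s q) else None.
have E (l : seq (elt N)) := countable_enum (countable_form cS cF cR (lctx l)).
pose en l := projT1 (cid (E l)).
have enP l : forall p, exists k, en l k = Some p := projT2 (cid (E l)).
have [sk skP] : exists sk : nat -> seq (elt N) -> elt N,
  forall k l s (q : form (scons s (lctx l))), en l k = Some (All q) ->
    (exists x, sat q (vcons x (lval l))) ->
    exists x, sk k l = existT _ s x /\ sat q (vcons x (lval l)).
  suff /choice[sk skP] : forall kl : nat * seq (elt N), exists y : elt N,
      forall s (q : form (scons s (lctx kl.2))), en kl.2 kl.1 = Some (All q) ->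
      (exists x, sat q (vcons x (lval kl.2))) ->
      exists x, y = existT _ s x /\ sat q (vcons x (lval kl.2)).
    by exists (fun k l => sk (k, l)) => k l; exact: skP (k, l).
  case=> k l /=.
  case: (EM (exists s (q : form (scons s (lctx l))), en l k = Some (All q) /\
      exists x, sat q (vcons x (lval l)))) => [[s [q [enk [x qx]]]]|h].
    exists (existT _ s x) => s' q'; rewrite enk => /Some_inj/(congr1 (@unAll _ _))/Some_inj e _.
    have e1 := existT_inj1 e; subst s'; have <- := existT_injr e.
    by exists x.
  by exists x0 => s q enk qx; case: h; exists s, q.
(* Odd indices carry [op], even ones the Skolem functions. *)
have [A [cA A0A clA]] := countable_closure x0
  (fun k => if odd k then op k./2 else sk k./2) cA0.
exists A; split=> // [l lA s q qx|k l lA]; last first.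
  by have := clA k.*2.+1 l lA; rewrite /= odd_double /= uphalf_double.
have [k enk] := enP l (All q).
have [x [skE qsx]] := skP _ _ _ _ enk qx.
by exists x => //; rewrite -skE; have := clA k.*2 l lA; rewrite odd_double doubleK.
Qed.

Lemma countable_submodel (L : lang) (N : structure L) (x0 : elt N) (A0 : set (elt N)) :
  countable_lang L -> countable A0 ->
  exists (N0 : structure L) (e : elem_emb N0 N),
    countable_structure N0 /\ forall s x, A0 (existT _ s x) -> exists y, e s y = x.
Proof.
move=> cL cA0.
have [A [cA A0A /tv_substructure[N0 [e [eA /(_ cA) cN0]]] _]] :=
  lowenheim_skolem x0 (fun _ _ => x0) cL cA0.
by exists N0, e; split=> // s x /A0A/eA.
Qed.

(** * Countably categorical theories *)

Definition iso_emb (L : lang) (M N : structure L) (x : iso M N) : elem_emb M N :=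
  ElemEmb (fun n g p v => iso_sat x p v).

Lemma emb_inj (L : lang) (M N : structure L) (e : elem_emb M N) s :
  injective (e s).
Proof.
move=> a b.
by have [_] := pelem_inj (pelem_emb e) (erefl (e s a)) (erefl (e s b)).
Qed.

(** Invariance is required of [h] and of its inverse, since an automorphism may map the image
    properly into itself. *)
Lemma aut_restrict (L : lang) (M N : structure L) (e : elem_emb M N) (h : aut N) :
  (forall s x, exists y, e s y = h s (e s x)) ->
  (forall s x, exists y, e s y = isov h (e s x)) ->
  exists k : aut M, forall s x, e s (k s x) = h s (e s x).
Proof.
move=> H H'.
pose k s x := projT1 (cid (H s x)); have kP s x : e s (k s x) = _ := projT2 (cid (H s x)).
pose k' s x := projT1 (cid (H' s x)); have k'P s x : e s (k' s x) = _ := projT2 (cid (H' s x)).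
unshelve eexists.
  apply: (@Iso _ _ _ k k').
  - by move=> s x; apply: (emb_inj (e := e)); rewrite k'P kP isofK.
  - by move=> s x; apply: (emb_inj (e := e)); rewrite kP k'P isovK.
  - move=> f v; apply: (emb_inj (e := e)); rewrite kP.
    have ef w : e _ (funI M f w) = funI N f (fun i => e _ (w i)).
      pose g := scons (fcod f) (@fdom L f).
      have := emb_elem e (Eq (Var g None) (App (fun i => Var g (Some i))))
        (vcons (funI M f w) w).
      by case=> /(_ erefl) /=.
    rewrite !ef iso_fun; congr funI.
    by apply: functional_extensionality_dep => i; rewrite kP.
  - move=> r v.
    have er w : relI M r w <-> relI N r (fun i => e _ (w i)).
      exact: (emb_elem e (Rel (fun i => Var (@rdom L r) i)) w).
    rewrite !er (iso_rel h).
    suff -> : (fun i => e _ (k _ (v i))) = (fun i => h _ (e _ (v i))) by [].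
    by apply: functional_extensionality_dep => i; rewrite kP.
exact: kP.
Qed.

Lemma countable_In (T : Type) (l : seq T) : countable [set x | List.In x l].
Proof.
elim: l => [|x l IH].
  have -> : [set y | List.In y [::]] = @set0 T by apply/seteqP; split.
  exact: countable0.
have -> : [set y | List.In y (x :: l)] = [set x] `|` [set y | List.In y l].
  by apply/seteqP; split=> y /= [->|]; [left|right|left|right].
by apply: countableU => //; exact: countable1.
Qed.

Definition emap (L : lang) (M N : structure L) (f : forall s, M s -> N s)
    (x : elt M) : elt N := existT _ (projT1 x) (f _ (projT2 x)).

(** * Definable orbits from categoricity *)

Section RyllNardzewski.
Variables (L : lang) (M N : structure L) (K : Type).
Local Notation S := (srt L).
Hypotheses (cL : countable_lang L) (cM : countable_structure M).
Hypothesis M_cat : forall P : structure L,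
  countable_structure P -> elem_equiv M P -> isomorphic M P.
Variables (e : elem_emb M N) (x0 : elt N).
Hypotheses (satN : saturated K N) (homN : strongly_homogeneous K N).
Hypothesis K_nat : small K [set: nat].

Lemma emb_range (N0 : structure L) (e0 : elem_emb N0 N) :
  countable_structure N0 ->
  exists f : elem_emb M N, forall s x, (exists y, f s y = x) <-> exists y, e0 s y = x.
Proof.
move=> cN0; have MN : elem_equiv M N0.
  by move=> p; rewrite (elem_equiv_emb e) (elem_equiv_emb e0).
have [k] := M_cat cN0 MN; exists (emb_comp (iso_emb k) e0) => s x.
by split=> -[y <-]; [exists (k s y)|exists (isov k y); rewrite /= isovK].
Qed.

(** Any countable set lies in a copy of [M], so every type of a finite tuple is realized in [M]. *)
Lemma emb_cover (A0 : set (elt N)) : countable A0 ->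
  exists f : elem_emb M N, forall s x, A0 (existT _ s x) -> exists y, f s y = x.
Proof.
move=> cA0; have [N0 [e0 [cN0 A0e]]] := countable_submodel x0 cL cA0.
by have [f fP] := emb_range e0 cN0; exists f => s x /A0e/fP.
Qed.

Inductive graph n (g : idx n -> S) (v w : forall i, N (g i)) :
    forall s, N s -> N s -> Prop :=
| Graph i : graph v w (v i) (w i).

Lemma tuple_hom n (g : idx n -> S) (v w : forall i, N (g i)) :
  (forall p : form g, sat p v -> sat p w) ->
  exists h : aut N, forall i, h _ (v i) = w i.
Proof.
move=> vw; have {}vw (p : form g) : sat p v <-> sat p w.
  by split=> [|pw]; [exact: vw|apply: contrapT => /(vw (Not p)) /(_ pw)].
have eR : pelem (graph v w).
  move=> m g' p v' w' h.
  have H i : exists t : term g (g' i), eval v t = v' i /\ eval w t = w' i.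
    by case: (h i) => j; exists (Var g j).
  pose r i := projT1 (cid (H i)).
  have -> : v' = fun i => eval v (r i).
    by apply: functional_extensionality_dep => i; case: (projT2 (cid (H i))).
  have -> : w' = fun i => eval w (r i).
    by apply: functional_extensionality_dep => i; case: (projT2 (cid (H i))).
  by rewrite -!sat_fsubst.
have [|h hP] := pelem_hom homN eR; last by exists h => i; apply: hP.
apply: small_le K_nat _.
have /subset_card_le D : dom (graph v w) `<=` range (fun i => existT N (g i) (v i)).
  by move=> [s a] [b /= [i]]; exists i.
apply: card_le_trans D _; apply: card_le_trans (card_image_le _ _) _.
exact: inj_countable (@idxnat_inj n).
Qed.

(** Isolation of the type of [v], with the orbit of [v] in place of its type; by [tuple_hom] the two
    agree. *)
Definition isolated n (g : idx n -> S) (v : forall i, N (g i)) :=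
  exists2 t : form g, sat t v &
    forall w, sat t w -> exists h : aut N, forall i, h _ (v i) = w i.

(* Every type is realized in M, so there are only countably many; if no type
   below p were isolated, they could be excluded one after the other. *)
Lemma isolated_dense n (g : idx n -> S) (v : forall i, N (g i)) s
    (p : form (scons s g)) :
  isolated v -> (exists x, sat p (vcons x v)) ->
  exists2 x, sat p (vcons x v) & isolated (vcons x v).
Proof.
move=> [t tv_ tP] [x px]; apply: contrapT => /forall2NP no.
have cT : countable [set: forall i, M (scons s g i)].
  apply: countable_tuples => i; have [f fI] := countable_inj cM.
  apply: (@inj_countable _ (nat : countType) (fun a => f (existT _ _ a))).
  by move=> a b /fI; exact: existT_injr.
have [q qP] := countable_enum cT.
pose good (c : form (scons s g)) := (exists y, sat c (vcons y v)) /\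
  forall y, sat c (vcons y v) -> sat p (vcons y v).
(* One step shrinks a formula [c] below [p] so that no solution over [v] has the type of the [k]-th
   tuple of [M]. *)
have /choice[nx nxP] : forall ck : form (scons s g) * nat, exists c',
    good ck.1 -> [/\ good c',
      forall y, sat c' (vcons y v) -> sat ck.1 (vcons y v) &
      forall y u, sat c' (vcons y v) -> q ck.2 = Some u ->
        ~ forall f, sat f u <-> sat f (vcons y v)].
  case=> c k /=; case: (EM (good c)) => [[[y cy] cp]|]; last by exists c.
  case: (no y) => // [ny|niso]; first by case: ny; exact: cp.
  have [w [tw cw nw]] : exists w, [/\ sat (fwk s t) w, sat c w &
      ~ exists h : aut N, forall i, h _ (vcons y v i) = w i].
    apply: contrapT => h; apply: niso; exists (And c (fwk s t)).
      by rewrite sat_And sat_fwk.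
    move=> w /sat_And[cw tw]; apply: contrapT => hw; apply: h.
    by exists w.
  (* As [t] isolates [v], the tail of [w] can be moved back onto [v]; its head then becomes a second
     solution [y'] of [c], whose type over [v] differs from that of [y]. *)
  move: tw; rewrite sat_fwk => /tP[h hv].
  pose y' := isov h (w None).
  have y'v : (fun i => h _ (vcons y' v i)) = w.
    apply: functional_extensionality_dep => -[i|/=]; first exact: hv.
    by rewrite /y' isovK.
  have cy' : sat c (vcons y' v) by apply/(iso_sat h); rewrite y'v.
  have [f fy nfy'] : exists2 f : form (scons s g),
      sat f (vcons y v) & ~ sat f (vcons y' v).
    apply: contrapT => /forall2NP H; apply: nw.
    have [|h' h'P] := @tuple_hom _ _ (vcons y v) (vcons y' v).
      by move=> f fy; case: (H f) => // /contrapT.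
    by exists (h * h')%g => i; rewrite /= h'P -y'v.
  have split_c (d : form (scons s g)) : (exists y, sat c (vcons y v) /\ sat d (vcons y v)) ->
      (forall u, q k = Some u -> ~ sat d u) ->
      exists c', good c -> [/\ good c',
      forall y, sat c' (vcons y v) -> sat c (vcons y v) &
      forall y u, sat c' (vcons y v) -> q k = Some u ->
        ~ forall f, sat f u <-> sat f (vcons y v)].
    move=> [z cdz] nd; exists (And c d) => _; split.
    - by split=> [|z' /sat_And[/cp]//]; exists z; apply/sat_And.
    - by move=> z' /sat_And[].
    - by move=> z' u /sat_And[_ dz'] /nd ndu /(_ d) [_ /(_ dz')].
  (* The formula [f] separates [y] from [y']. The new condition is whichever of [f] and its negation
     fails at the [k]-th tuple; both are consistent with [c] over [v]. *)
  case: (EM (exists2 u, q k = Some u & sat f u)) => [[u qk fu]|nu].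
    apply: (split_c (Not f)); first by exists y'.
    by move=> u'; rewrite qk => -[<-] /(_ fu).
  apply: (split_c f); first by exists y.
  by move=> u qk fu; apply: nu; exists u.
pose c := fix c k := if k is k'.+1 then nx (c k', k') else p.
have cgood k : good (c k).
  elim: k => [|k IH] /=; first by split=> //; exists x.
  by case: (nxP (c k, k) IH).
have cmono k m y : sat (c (k + m)%N) (vcons y v) -> sat (c k) (vcons y v).
  elim: m => [|m IH]; rewrite ?addn0 // addnS /= => h; apply: IH.
  by case: (nxP (c (k + m)%N, (k + m)%N) (cgood _)) => _ + _; apply.
pose T : set (pform N s) := range (fun k => PForm (c k) v).
have [] := @satN (range (fun i => existT N (g i) (v i))) s T.
- apply: small_le K_nat _; apply: card_le_trans (card_image_le _ _) _.
  exact: inj_countable (@idxnat_inj n).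
- by move=> _ [k _ <-].
- move=> F /finite_set_In[l Fl] FT.
  have [m mP] : exists m, forall r, List.In r l -> exists2 k, (k <= m)%N & r = PForm (c k) v.
    have : forall r, List.In r l -> T r by move=> r /Fl/FT.
    elim: l {Fl} => [|r l IH] lT; first by exists 0.
    have [m mP] := IH (fun r' h => lT r' (or_intror h)).
    have [k _ rk] := lT r (or_introl erefl).
    exists (maxn k m) => r' [<-|/mP[k' k'm ->]]; first by exists k; rewrite ?leq_maxl.
    by exists k' => //; rewrite leq_max k'm orbT.
  have [[y cy] _] := cgood m; exists y => r /Fl/mP[k km ->].
  by rewrite /psat /=; apply: (@cmono k (m - k)%N); rewrite subnKC.
move=> y Ty.
have cy k : sat (c k) (vcons y v) by apply: (Ty (PForm (c k) v)); exists k.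
have cA : countable (range (fun i => existT N (scons s g i) (vcons y v i))).
  apply: card_le_trans (card_image_le _ _) _.
  exact: inj_countable (@idxnat_inj n.+1).
(* A copy of [M] containing [v] and the limit [y] shows that their type is that of some [q k],
   contrary to [c k.+1]. *)
have [f fP] := emb_cover cA.
have H i : exists z, f _ z = vcons y v i by apply: fP; exists i.
pose u i := projT1 (cid (H i)).
have uE : (fun i => f _ (u i)) = vcons y v.
  by apply: functional_extensionality_dep => i; exact: projT2 (cid (H i)).
have [k qk] := qP u.
have [_ _ /(_ y u (cy k.+1) qk)] := nxP (c k, k) (cgood k).
by apply => r; rewrite (emb_elem f) uE.
Qed.

(** A Henkin construction of an atomic model inside [N]: each witness is chosen by [isolated_dense],
    so that the whole list stays isolated. *)
Lemma atomic_sequence : exists a : nat -> seq (elt N),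
  [/\ a 0 = [::], forall k, isolated (lval (a k)),
      forall k, exists x, a k.+1 = x :: a k &
      forall k s (p : form (scons s (lctx (a k)))),
        (exists x, sat p (vcons x (lval (a k)))) ->
        exists m x, sat p (vcons x (lval (a k))) /\ List.In (existT _ s x) (a m)].
Proof.
case: cL => cS cF cR.
pose unAll n (g : idx n -> srt L) (p : form g) :
    option {s & form (scons s g)} :=
  if p is All _ g s q then Some (existT (fun s => form (scons s g)) s q) else None.
have E (l : seq (elt N)) := countable_enum (countable_form cS cF cR (lctx l)).
pose en l := projT1 (cid (E l)).
have enP l : forall p, exists k, en l k = Some p := projT2 (cid (E l)).
(* Stage [k] treats the formula of rank [logn 3 k] over the earlier list of length [logn 2 k]. Lists
   grow at the head, so that list is a suffix of the current one. *)
pose l1 k (l : seq (elt N)) := drop (size l - logn 2 k)%N l.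
pose task k l (y : elt N) := forall s (q : form (scons s (lctx (l1 k l)))),
  en (l1 k l) (logn 3 k) = Some (All q) ->
  (exists x, sat q (vcons x (lval (l1 k l)))) ->
  exists x, sat q (vcons x (lval (l1 k l))) /\ y = existT _ s x.
have /choice[nx nxP] : forall kl : nat * seq (elt N), exists y : elt N,
    isolated (lval kl.2) -> isolated (lval (y :: kl.2)) /\ task kl.1 kl.2 y.
  case=> k l /=; case: (EM (isolated (lval l))) => [isol|]; last by exists x0.
  case: (EM (exists s (q : form (scons s (lctx (l1 k l)))),
      en (l1 k l) (logn 3 k) = Some (All q) /\
      exists x, sat q (vcons x (lval (l1 k l))))) => [[s [q [enk [x qx]]]]|h].
    have [r rE] : exists r : forall i, term (lctx l) (lctx (l1 k l) i),
        (fun i => eval (lval l) (r i)) = lval (l1 k l).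
      apply: list_terms => i.
      rewrite -[X in List.In _ X](cat_take_drop (size l - logn 2 k)%N).
      by apply/List.in_or_app; right; exact: lval_In.
    have qE z : sat (fsubst q (slift r s)) (vcons z (lval l)) <->
        sat q (vcons z (lval (l1 k l))) by rewrite sat_fsubst eval_slift rE.
    have [|y /qE qy isoy] := @isolated_dense _ _ _ s (fsubst q (slift r s)) isol.
      by exists x; apply/qE.
    exists (existT _ s y) => _; split=> // s' q'.
    rewrite enk => /Some_inj/(congr1 (@unAll _ _))/Some_inj e1 _.
    have e2 := existT_inj1 e1; subst s'; have <- := existT_injr e1.
    by exists y.
  have [|y _ isoy] := @isolated_dense _ _ _ (projT1 x0) (Not (Bot _)) isol.
    by exists (projT2 x0).
  exists (existT _ (projT1 x0) y) => _; split=> // s q enk qx.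
  by case: h; exists s, q.
pose a := fix a k := if k is k'.+1 then nx (k', a k') :: a k' else [::].
have iso_a k : isolated (lval (a k)).
  elim: k => [|k IH]; last by case: (nxP (k, a k) IH).
  by exists (Not (Bot _)) => // w _; exists (1 : aut N)%g => -[].
exists a; split=> // [k|k s p px]; first by exists (nx (k, a k)).
have [b enb] := enP (a k) (All p).
(* The stage with exponents [k] and [b]. It comes no earlier than [k], so [a k] is already built. *)
pose m := (2 ^ k * 3 ^ b)%N.
have lm2 : logn 2 m = k.
  by rewrite /m lognM ?expn_gt0 // pfactorK // lognX (@logn_coprime 2 3) // muln0 addn0.
have lm3 : logn 3 m = b.
  by rewrite /m lognM ?expn_gt0 // pfactorK // lognX (@logn_coprime 3 2) // muln0 add0n.
have km : (k <= m)%N.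
  by rewrite -lm2; apply/ltnW/ltn_logl; rewrite muln_gt0 !expn_gt0.
have sz j : size (a j) = j by elim: j => //= j ->.
have dr j : drop j (a (j + k)%N) = a k by elim: j => [|j IH] //=; rewrite drop0.
have l1E : l1 m (a m) = a k by rewrite /l1 sz lm2 -[X in a X](subnK km) dr.
have [_] := nxP (m, a m) (iso_a m); rewrite /task /= l1E lm3.
move=> /(_ s p enb px)[x [px' nxE]]; exists m.+1, x; split=> //=.
by left.
Qed.

(** The atomic sequence is a countable elementary submodel, hence a copy of [M]. So every tuple of
    [M] extends to one of isolated type, and every list of [N] lies in some copy of [M], to which
    this is carried over. *)
Lemma tuple_isolated (l0 : seq (elt N)) :
  exists n (g : idx n -> S) (w : forall i, N (g i)),
    isolated w /\ forall x, List.In x l0 -> exists i, existT N (g i) (w i) = x.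
Proof.
have [a [a0 aiso aS atv]] := atomic_sequence.
have amono k m x : List.In x (a k) -> List.In x (a (k + m)%N).
  elim: m => [|m IH]; rewrite ?addn0 // => /IH h; rewrite addnS.
  by have [y ->] := aS (k + m)%N; right.
pose A : set (elt N) := [set x | exists k, List.In x (a k)].
have Al l : (forall x, List.In x l -> A x) ->
    exists k, forall x, List.In x l -> List.In x (a k).
  elim: l => [|x l IH] lA; first by exists 0.
  have [k kP] := IH (fun y yl => lA y (or_intror yl)).
  have [m xm] := lA x (or_introl erefl).
  by exists (m + k)%N => y [<-|/kP]; [exact: amono|rewrite addnC; exact: amono].
have tvA : tv A.
  move=> l /Al[k lk]; apply: (@tv_tuple _ _ A (a k)) => [i|s p px].
    by apply: lk; exact: lval_In.
  by have [m [x [px' xm]]] := atv k s p px; exists x => //; exists m.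
have cA : countable A.
  have -> : A = \bigcup_(k in [set: nat]) [set x | List.In x (a k)].
    by apply/seteqP; split=> x [k]; [exists k|move=> _; exists k].
  apply: bigcup_countable => // k _; exact: countable_In.
have [N0 [e0 [e0A /(_ cA) cN0]]] := tv_substructure tvA.
have [f0 f0P] := emb_range e0 cN0.
have [f fP] := emb_cover (countable_In l0).
have [lm lmE] : exists lm, map (emap f) lm = l0.
  elim: l0 fP => [|[s x] l IH] fP; first by exists [::].
  have [lm <-] := IH (fun s x xl => fP s x (or_intror xl)).
  by have [y <-] := fP s x (or_introl erefl); exists (existT _ s y :: lm).
have [k kP] : exists k, forall x, List.In x (map (emap f0) lm) -> List.In x (a k).
  apply: Al => x /List.in_map_iff[[s y] [<- _]].
  by apply/e0A/f0P; exists y.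
have H i : exists y, f0 _ y = lval (a k) i.
  by apply/f0P/e0A; exists k; exact: lval_In.
pose u i := projT1 (cid (H i)).
have uE : (fun i => f0 _ (u i)) = lval (a k).
  by apply: functional_extensionality_dep => i; exact: projT2 (cid (H i)).
exists (size (a k)), (lctx (a k)), (fun i => f _ (u i)); split.
  have [t tk tP] := aiso k.
  have tu : sat t u by apply/(emb_elem f0); rewrite uE.
  exists t; first exact/(emb_elem f).
  have [|h1 h1P] := tP (fun i => f _ (u i)); first exact/(emb_elem f).
  move=> w /tP[h2 h2P]; exists (h2 * h1^-1)%g => i.
  by rewrite -h1P -h2P /= isofK.
rewrite -lmE => _ /List.in_map_iff[[s y] [<- ylm]].
have /In_lval[i /= iE] : List.In (emap f0 (existT _ s y)) (a k).
  by apply: kP; exact: List.in_map.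
exists i; move: iE (congr1 (fun v => v i) uE) => /=.
move: (lval (a k) i) (u i); move: (lctx (a k) i) => s' b c e1 e2.
rewrite -e2 in e1; have e3 := existT_inj1 e1; subst s'.
by have /emb_inj-> := existT_injr e1.
Qed.

(* A countable elementary submodel closed under enough automorphisms of N is
   homogeneous, and it is isomorphic to M. *)
Lemma M_homogeneous n (g : idx n -> S) (u w : forall i, M (g i)) :
  (forall p : form g, sat p u <-> sat p w) ->
  exists k : aut M, forall i, k _ (u i) = w i.
Proof.
move=> uw.
have /choice[H HP] : forall lw : seq (elt N) * seq (elt N), exists h : aut N,
    (exists h' : aut N, map (emap h') lw.1 = lw.2) -> map (emap h) lw.1 = lw.2.
  move=> [l l'] /=; case: (EM (exists h' : aut N, map (emap h') l = l')).
    by move=> [h hl]; exists h.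
  by move=> no; exists (1 : aut N)%g => /no.
(* The argument codes an element followed by two lists of equal length. The operations apply to the
   element an automorphism taking the first list to the second, or the inverse automorphism;
   [aut_restrict] needs closure under both. *)
pose op k (l : seq (elt N)) := if l is x :: l' then
  let h := H (take (size l')./2 l', drop (size l')./2 l') in
  if k is 0 then emap h x else emap (h^-1)%g x else x0.
have [A [cA _ tvA clA]] := lowenheim_skolem x0 op cL (@countable0 (elt N)).
have [N0 [e0 [e0A /(_ cA) cN0]]] := tv_substructure tvA.
have [f fP] := emb_range e0 cN0.
have fA x : A (emap f x) by apply/e0A/fP; exists (projT2 x).
have Af s x : A (existT _ s x) -> exists y, f s y = x by move=> /e0A/fP.
pose lu := idxseq (fun i => existT N (g i) (f _ (u i))).
pose lw := idxseq (fun i => existT N (g i) (f _ (w i))).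
have [h hP] : exists h : aut N, forall i, h _ (f _ (u i)) = f _ (w i).
  by apply: tuple_hom => p; rewrite -!(emb_elem f) uw.
have mapseq (k : aut N) m (d : idx m -> S) (v : forall i, N (d i)) :
    map (emap k) (idxseq (fun i => existT N (d i) (v i))) =
    idxseq (fun i => existT N (d i) (k _ (v i))).
  by elim: m d v => //= m IH d v; congr cons; exact: IH.
have luw : map (emap (H (lu, lw))) lu = lw.
  apply: HP; exists h; rewrite mapseq /lw; congr idxseq.
  by apply: functional_extensionality_dep => i; rewrite hP.
have lA x y : List.In x (emap f y :: lu ++ lw) -> A x.
  case=> [<-|/List.in_app_iff]; [exact: fA|case=> h'].
    by have [i <-] := (In_idxseq _ _).1 h'; exact: (fA (existT _ _ (u i))).
  by have [i <-] := (In_idxseq _ _).1 h'; exact: (fA (existT _ _ (w i))).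
have szE : size lw = size lu by rewrite -luw size_map.
have opE k y : op k (emap f y :: lu ++ lw) =
    if k is 0 then emap (H (lu, lw)) (emap f y)
    else emap ((H (lu, lw))^-1)%g (emap f y).
  by rewrite /op size_cat szE addnn doubleK take_size_cat ?drop_size_cat.
have [||k kP] := aut_restrict (e := f) (h := H (lu, lw)).
- move=> s x; apply: Af.
  by have := clA 0 _ (fun y => lA y (existT _ s x)); rewrite opE.
- move=> s x; apply: Af.
  by have := clA 1 _ (fun y => lA y (existT _ s x)); rewrite opE.
exists k => i; apply: (emb_inj (e := f)); rewrite kP.
have := luw; rewrite mapseq => /idxseq_inj /(_ i) /=; exact: existT_injr.
Qed.

Lemma tuple_orbit (l0 : seq (elt N)) :
  exists n (g : idx n -> S) (w : forall i, N (g i)) (t : form g),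
    [/\ sat t w, forall x, List.In x l0 -> exists i, existT N (g i) (w i) = x &
        forall u u' : forall i, M (g i), sat t u -> sat t u' ->
          exists k : aut M, forall i, k _ (u i) = u' i].
Proof.
have [n [g [w [[t tw tP] wl0]]]] := tuple_isolated l0.
(* Realizations of [t] in [M] lie in one orbit of [N], hence have the same type, and homogeneity of
   [M] moves one to the other. *)
exists n, g, w, t; split=> // u u' /(emb_elem e)/tP[h hP] /(emb_elem e)/tP[h' h'P].
apply: M_homogeneous => p; rewrite !(emb_elem e).
have <- : (fun i => h _ (w i)) = (fun i => e _ (u i)).
  exact: functional_extensionality_dep.
have <- : (fun i => h' _ (w i)) = (fun i => e _ (u' i)).
  exact: functional_extensionality_dep.
by rewrite -!iso_sat.
Qed.

End RyllNardzewski.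

(** * Reducts and the action of the group sort *)

Section Reduct.
Variables (L : lang) (M : structure L).
Local Notation S := (srt L).
Local Notation EL := (elang M).

Fixpoint ttr n (g : idx n -> S) s (t : term g s) m (g' : idx m -> srt EL)
    (r : forall i, term (L := EL) g' (Some (g i))) : term (L := EL) g' (Some s) :=
  match t with
  | Var i => r i
  | App f a => App (L := EL) (f := EFun f) (fun i => ttr (a i) r)
  end.

Definition trlift n (g : idx n -> S) m (g' : idx m -> srt EL)
    (r : forall i, term (L := EL) g' (Some (g i))) s :
    forall i, term (L := EL) (scons (Some s : srt EL) g') (Some (scons s g i)) :=
  fun i => match i with
  | Some j => wk (L := EL) (Some s) (r j)
  | None => Var (L := EL) (scons (Some s : srt EL) g') None
  end.

(** The substitution [r] is carried along because, under a quantifier, the context of sorts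
    [Some (scons s g i)] is not convertible to an extension of [g'] by [Some s]. *)
Fixpoint ftr n (g : idx n -> S) (p : form g) : forall m (g' : idx m -> srt EL),
    (forall i, term (L := EL) g' (Some (g i))) -> form (L := EL) g' :=
  match p with
  | Bot _ _ => fun _ g' _ => Bot g'
  | Eq _ _ _ t u => fun _ _ r => Eq (ttr t r) (ttr u r)
  | Rel _ _ R a => fun _ _ r =>
      Rel (L := EL) (r := ERel M R) (fun i => ttr (a i) r)
  | Imp _ _ p q => fun _ _ r => Imp (ftr p r) (ftr q r)
  | All _ g s p => fun _ g' r =>
      All (L := EL) (s := Some s) (ftr p (trlift r s))
  end.

Lemma eval_ttr (N : structure EL) n (g : idx n -> S) s (t : term g s) m
    (g' : idx m -> srt EL) (r : forall i, term (L := EL) g' (Some (g i)))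
    (v : forall i, N (g' i)) :
  eval v (ttr t r) = eval (M := reduct N) (fun i => eval v (r i)) t.
Proof.
elim: t => //= f a IH.
apply: (congr1 (funI N (EFun f : Defs.fsym EL))).
exact: functional_extensionality_dep.
Qed.

Lemma sat_ftr (N : structure EL) n (g : idx n -> S) (p : form g) m
    (g' : idx m -> srt EL) (r : forall i, term (L := EL) g' (Some (g i)))
    (v : forall i, N (g' i)) :
  sat (ftr p r) v <-> sat (M := reduct N) p (fun i => eval v (r i)).
Proof.
elim: p m g' r v => {n g} /= [n g|n g s t u|n g R a|n g p IHp q IHq|n g s p IH]
  m g' r v.
- by [].
- by rewrite !eval_ttr.
- suff -> : (fun i => eval v (ttr (a i) r)) =
    (fun i => eval (M := reduct N) (fun j => eval v (r j)) (a i)) by [].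
  by apply: functional_extensionality_dep => i; rewrite eval_ttr.
- by split=> h /IHp/h/IHq.
- have E (x : N (Some s)) : (fun i => eval (M := N) (vcons x v) (trlift r s i)) =
      vcons (M := reduct N) x (fun i => eval v (r i)).
    by apply: functional_extensionality_dep; case=> //= j; rewrite eval_wk.
  by split=> h x; move: (h x); rewrite IH E.
Qed.

Definition emb_reduct (P Q : structure EL) (j : elem_emb P Q) :
  elem_emb (reduct P) (reduct Q).
Proof.
apply: (@ElemEmb _ (reduct P) (reduct Q) (fun s x => j (Some s) x)) => n g p v.
pose r i := Var (L := EL) (fun i => Some (g i)) i.
apply: iff_trans (iff_sym (sat_ftr (N := P) p r v)) _.
apply: iff_trans (emb_elem j (ftr p r) v) _.
exact: sat_ftr.
Defined.

Lemma sat_reduct_expansion n (g : idx n -> S) (p : form g) (v : forall i, M (g i)) :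
  sat (M := reduct (expansion M)) p v <-> sat p v.
Proof. by case: M v => c f r v. Qed.

Definition emb_base (N : structure EL) (e : elem_emb (expansion M) N) :
  elem_emb M (reduct N).
Proof.
apply: (@ElemEmb _ M (reduct N) (fun s x => e (Some s) x)) => n g p v.
apply: iff_trans (iff_sym (sat_reduct_expansion p v)) _.
exact: (emb_elem (emb_reduct e)).
Defined.

Definition iso_reduct (N : structure EL) (t : aut N) : aut (reduct N).
Proof.
apply: (@Iso _ (reduct N) (reduct N) (fun s a => t (Some s) a)
  (fun s a => isov t (s := Some s) a)).
- by move=> s a; rewrite isofK.
- by move=> s a; rewrite isovK.
- by move=> f v; exact: (iso_fun t (f := EFun f)).
- by move=> r v; exact: (iso_rel t (r := ERel M r)).
Defined.

Definition tact n (g : idx n -> srt EL) s (x : term (L := EL) g None)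
    (a : term (L := EL) g (Some s)) : term (L := EL) g (Some s) :=
  App (L := EL) (f := EAct s) (fun i : idx 2 => match i as i
    return term (L := EL) g (@fdom EL (EAct s) i) with Some _ => a | None => x end).

Lemma eval_tact (N : structure EL) n (g : idx n -> srt EL) s
    (x : term (L := EL) g None) (a : term (L := EL) g (Some s))
    (v : forall i, N (g i)) :
  eval v (tact x a) = gact (eval v x) (eval v a).
Proof.
rewrite /gact /=; apply: (congr1 (funI N (EAct s : Defs.fsym EL))).
by apply: functional_extensionality_dep; case.
Qed.

Section Action.
Variables (N : structure EL) (e : elem_emb (expansion M) N).

Definition cact (s : S) : idx 3 -> srt EL :=
  scons None (scons None (scons (Some s) (@nilc _))).

Lemma gactM (x y : Gext e) s (a : N (Some s)) :
  gact (x * y : Gext e)%g a = gact (x : N None) (gact (y : N None) a).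
Proof.
pose v0 : term (L := EL) (cact s) None := Var (L := EL) (cact s) None.
pose v1 : term (L := EL) (cact s) None := Var (L := EL) (cact s) (Some None).
pose v2 : term (L := EL) (cact s) (Some s) :=
  Var (L := EL) (cact s) (Some (Some None)).
have := elem_all e (p := Eq (tact (tmul v0 v1) v2) (tact v0 (tact v1 v2))).
move=> /(_ _ (vcons (x : N None) (vcons (y : N None) (vcons a (@nilv _ N))))).
rewrite /sat !eval_tact eval_tmul; apply=> v.
by rewrite /sat !eval_tact eval_tmul.
Qed.

Lemma gact1 s (a : N (Some s)) : gact (1 : Gext e)%g a = a.
Proof.
pose g : idx 1 -> srt EL := scons (Some s) (@nilc _).
pose v0 : term (L := EL) g (Some s) := Var (L := EL) g None.
have := elem_all e (p := Eq (tact (tone g) v0) v0).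
move=> /(_ _ (vcons a (@nilv _ N))); rewrite /sat eval_tact eval_tone; apply=> v.
by rewrite /sat eval_tact eval_tone.
Qed.

Lemma gact_fun (x : N None) (f : Defs.fsym L) (v : forall i, N (Some (@fdom L f i))) :
  gact x (funI N (EFun f) v) = funI N (EFun f) (fun i => gact x (v i)).
Proof.
pose g : idx (farity f).+1 -> srt EL := scons None (fun i => Some (@fdom L f i)).
pose x0 : term (L := EL) g None := Var (L := EL) g None.
pose vs i : term (L := EL) g (Some (@fdom L f i)) := Var (L := EL) g (Some i).
have E (P : structure EL) (w : forall i, P (g i)) :
    sat (Eq (tact x0 (App (L := EL) (f := EFun f) vs))
      (App (L := EL) (f := EFun f) (fun i => tact x0 (vs i)))) w <->
    gact (w None) (funI P (EFun f) (fun i => w (Some i))) =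
    funI P (EFun f) (fun i => gact (w None) (w (Some i))).
  rewrite /sat eval_tact /=.
  suff -> : (fun i => eval w (tact x0 (vs i))) =
    (fun i => gact (w None) (w (Some i))) by [].
  by apply: functional_extensionality_dep => i; rewrite eval_tact.
apply: (E N (vcons (x : N None) v)).1; apply: (elem_all e) => w; apply/E.
exact: (iso_fun (w None : aut M)).
Qed.

Lemma gact_rel (x : N None) (r : rsym L) (v : forall i, N (Some (@rdom L r i))) :
  relI N (ERel M r) v <-> relI N (ERel M r) (fun i => gact x (v i)).
Proof.
pose g : idx (rarity r).+1 -> srt EL := scons None (fun i => Some (@rdom L r i)).
pose x0 : term (L := EL) g None := Var (L := EL) g None.
pose vs i : term (L := EL) g (Some (@rdom L r i)) := Var (L := EL) g (Some i).
pose A := Rel (L := EL) (r := ERel M r) vs.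
pose B := Rel (L := EL) (r := ERel M r) (fun i => tact x0 (vs i)).
have E (P : structure EL) (w : forall i, P (g i)) :
    sat (And (Imp A B) (Imp B A)) w <->
    (relI P (ERel M r) (fun i => w (Some i)) <->
     relI P (ERel M r) (fun i => gact (w None) (w (Some i)))).
  rewrite sat_And /=.
  suff -> : (fun i => eval w (tact x0 (vs i))) =
    (fun i => gact (w None) (w (Some i))) by [].
  by apply: functional_extensionality_dep => i; rewrite eval_tact.
apply: (E N (vcons (x : N None) v)).1; apply: (elem_all e) => w; apply/E.
exact: (iso_rel (w None : aut M)).
Qed.

Definition act_aut (x : Gext e) : aut (reduct N).
Proof.
apply: (@Iso _ (reduct N) (reduct N) (fun s a => gact (x : N None) a)
  (fun s a => gact (x^-1 : Gext e)%g a)).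
- by move=> s a; rewrite -gactM mulVg gact1.
- by move=> s a; rewrite -gactM mulgV gact1.
- exact: gact_fun.
- exact: gact_rel.
Defined.

Lemma act_autM x y : act_aut (x * y)%g = (act_aut x * act_aut y)%g.
Proof. by apply: aut_ext => s a; rewrite /= gactM. Qed.

Lemma act_autV x : act_aut x^-1%g = (act_aut x)^-1%g.
Proof. by apply: aut_ext => s a. Qed.

(* The stabilizer of a finite tuple of M is one of the named open sets. *)
Lemma muP (x : Gext e) :
  mu x <-> forall s (m : M s), gact (x : N None) (e (Some s) m) = e (Some s) m.
Proof.
split=> [xmu s m|xM U oU U1].
  have oU : open_aut [set k : aut M | k s m = m].
    move=> k km; exists [set existT M s m]; split; first exact: finite_set1.
    by move=> h hk /=; rewrite hk.
  have := xmu _ oU erefl.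
  pose g1 : idx 1 -> srt EL := scons (Some s) (@nilc _).
  pose g : idx 2 -> srt EL := scons None g1.
  pose x0 : term (L := EL) g None := Var (L := EL) g None.
  pose m0 : term (L := EL) g (Some s) := Var (L := EL) g (Some None).
  pose p := Imp (Rel (L := EL) (r := EOpen oU) (fun=> x0)) (Eq (tact x0 m0) m0).
  have E (P : structure EL) (y : P None) (w : forall i, P (g1 i)) :
      sat p (vcons y w) <-> (gopen oU y -> gact y (w None) = w None).
    have -> : gact y (w None) = eval (vcons y w) (tact x0 m0) by rewrite eval_tact.
    by [].
  pose w1 : forall i, expansion M (g1 i) :=
    vcons (M := expansion M) (s := (Some s : srt EL)) m (@nilv _ _).
  have : sat (All p) (fun i => e _ (w1 i)).
    by apply/(emb_elem e) => y; apply/E.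
  by move=> /(_ x) /E; apply.
(* Conversely, [U] contains the stabilizer of a finite tuple of [M]; this inclusion is first order
   in the tuple and transfers to [N]. *)
have [F [/finite_set_In[l Fl] FU]] := oU 1%g U1.
pose g : idx (size l).+1 -> srt EL := scons None (fun i => Some (lctx l i)).
pose x0 : term (L := EL) g None := Var (L := EL) g None.
pose vs i : term (L := EL) g (Some (lctx l i)) := Var (L := EL) g (Some i).
have [q qP] := bigand (fun i => Eq (tact x0 (vs i)) (vs i)).
have qE (P : structure EL) (w : forall i, P (g i)) :
    sat q w <-> forall i, gact (w None) (w (Some i)) = w (Some i).
  by rewrite qP; split=> h i; have := h i; rewrite /sat eval_tact.
pose p := All (Imp q (Rel (L := EL) (r := EOpen oU) (fun=> x0))).
have : sat p (fun i => e (Some _) (lval l i)).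
  apply/(emb_elem e p (fun i => lval l i : expansion M (Some _))) => y /qE hy.
  apply: FU => s a /Fl /In_lval[i ia]; have := hy i => /=.
  move: (lval l i) ia; move: (lctx l i) => s' b ia.
  by have e1 := existT_inj1 ia; subst s'; rewrite (existT_injr ia).
by move=> /(_ x); apply; apply/qE => i; exact: xM.
Qed.

(** With the group as a sort, transitivity of [G] on the solutions of [t] is a first-order sentence
    of the expansion. *)
Lemma orbit_transfer n (g : idx n -> S) (t : form g) :
  (forall u u' : forall i, M (g i), sat t u -> sat t u' ->
     exists k : aut M, forall i, k _ (u i) = u' i) ->
  forall w w' : forall i, reduct N (g i), sat t w -> sat t w' ->
    exists x : N None, forall i, gact x (w i) = w' i.
Proof.
move=> H w w' tw tw'.
pose g' : idx n -> srt EL := fun i => Some (g i).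
pose lt i : term (L := EL) (catc g' g') (Some (g i)) := catl g' g' i.
pose rt i : term (L := EL) (catc g' g') (Some (g i)) := catr g' g' i.
pose sG : srt EL := None.
pose x0 : term (L := EL) (scons sG (catc g' g')) None :=
  Var (L := EL) (scons sG (catc g' g')) None.
have [q qP] := bigand (fun i => Eq (tact x0 (wk sG (lt i))) (wk sG (rt i))).
have qE (P : structure EL) (y : P None) (v : forall i, P (catc g' g' i)) :
    sat q (vcons y v) <-> forall i, gact y (eval v (lt i)) = eval v (rt i).
  by rewrite qP; split=> h i; have := h i; rewrite /sat eval_tact !eval_wk.
pose p := Imp (ftr t lt) (Imp (ftr t rt) (Ex q)).
have pE (P : structure EL) (v : forall i, P (catc g' g' i)) : sat p v <->
    (sat (M := reduct P) t (fun i => eval v (lt i)) ->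
     sat (M := reduct P) t (fun i => eval v (rt i)) ->
     exists y : P None, forall i, gact y (eval v (lt i)) = eval v (rt i)).
  split=> [h /sat_ftr hl /sat_ftr hr|h /sat_ftr hl /sat_ftr hr].
    by have /sat_Ex[y /qE yP] := h hl hr; exists y.
  by apply/sat_Ex; have [y yP] := h hl hr; exists y; apply/qE.
have : sat p (catv (M := N) (g1 := g') (g2 := g') w w').
  apply: (elem_all e) => v; apply/pE => /sat_reduct_expansion tl.
  by move=> /sat_reduct_expansion tr; exact: H.
have El i : eval (catv (M := N) (g1 := g') (g2 := g') w w') (lt i) = w i.
  exact: eval_catl.
have Er i : eval (catv (M := N) (g1 := g') (g2 := g') w w') (rt i) = w' i.
  exact: eval_catr.
move=> /pE; rewrite (functional_extensionality_dep El).
rewrite (functional_extensionality_dep Er) => /(_ tw tw')[x xP].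
by exists x => i; rewrite -Er -xP El.
Qed.

End Action.
End Reduct.

(** * Normal subgroups containing mu *)

Lemma iso_gact (L : lang) (M : structure L) (N : structure (elang M)) (t : aut N)
    (x : N None) s (a : N (Some s)) :
  t (Some s) (gact x a) = gact (t None x) (t (Some s) a).
Proof.
rewrite /gact (iso_fun t (f := EAct s)).
apply: (congr1 (funI N (EAct s : Defs.fsym (elang M)))).
by apply: functional_extensionality_dep; case.
Qed.

Section Realize.
Variables (L : lang) (M : structure L) (N : structure (elang M)) (K : Type).
Variable e : elem_emb (expansion M) N.
Local Notation S := (srt L).
Local Notation EL := (elang M).
Hypotheses (cL : countable_lang L) (cM : countable_structure M).
Hypothesis M_cat : forall P : structure L,
  countable_structure P -> elem_equiv M P -> isomorphic M P.
Variable x0 : elt (reduct N).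
Hypotheses (satN : saturated K N) (satrN : saturated K (reduct N)).
Hypotheses (homrN : strongly_homogeneous K (reduct N)).
Hypothesis K_nat : small K [set: nat].

(* An automorphism of the reduct agrees on finite tuples with elements of the
   group sort, since types over the empty set are isolated orbits. *)
Lemma aut_realized (h : aut (reduct N)) (A B : set (elt (reduct N))) :
  small K B -> A `<=` B -> (forall x, A x -> B (emap h x)) ->
  exists x : N None, forall s (a : reduct N s),
    A (existT _ s a) -> gact x a = h s a.
Proof.
move=> sB AB hAB.
pose g1 s : idx 2 -> srt EL := scons (Some s) (scons (Some s) (@nilc _)).
pose g s : idx 3 -> srt EL := scons None (g1 s).
pose v0 s : term (L := EL) (g s) None := Var (L := EL) (g s) None.
pose v1 s : term (L := EL) (g s) (Some s) := Var (L := EL) (g s) (Some None).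
pose v2 s : term (L := EL) (g s) (Some s) := Var (L := EL) (g s) (Some (Some None)).
pose p s : form (L := EL) (g s) := Eq (tact (v0 s) (v1 s)) (v2 s).
pose pv (z : elt (reduct N)) : forall i, N (g1 (projT1 z) i) :=
  vcons (M := N) (s := (Some (projT1 z) : srt EL)) (projT2 z)
    (vcons (M := N) (s := (Some (projT1 z) : srt EL)) (h _ (projT2 z)) (@nilv _ N)).
pose pf z : pform N None := PForm (p (projT1 z)) (pv z).
have pfE z x : psat (pf z) x <-> gact x (projT2 z) = h _ (projT2 z).
  have -> : gact x (projT2 z) = eval (vcons x (pv z)) (tact (v0 _) (v1 _)).
    by rewrite eval_tact.
  by [].
pose emb (z : elt (reduct N)) : elt N := existT N (Some (projT1 z)) (projT2 z).
have [] := @satN (emb @` B) None (pf @` A).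
- exact: small_le sB (card_image_le _ _).
- move=> _ [z Az <-] _ [[[[]|]|] _ <-].
    by exists (emap h z) => //; exact: hAB.
  by exists z => //; exact: AB.
- move=> F /finite_set_In[l Fl] FA.
  have [l0 l0P] : exists l0, forall q, List.In q l -> exists z, List.In z l0 /\ q = pf z.
    have : forall q, List.In q l -> (pf @` A) q by move=> q /Fl/FA.
    elim: l {Fl} => [|q l IH] lA; first by exists [::].
    have [l0 l0P] := IH (fun r h => lA r (or_intror h)).
    have [z _ zq] := lA q (or_introl erefl).
    exists (z :: l0) => r [<-|/l0P[y [yl ->]]]; first by exists z; split=> //; left.
    by exists y; split=> //; right.
  (* The finitely many elements concerned lie in a tuple [w] satisfying an orbit formula [t]. Its
     image under [h] satisfies [t] too, so one group element serves for all of them. *)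
  have [n [d [w [t [tw wl0 /(orbit_transfer e) H]]]]] :=
    tuple_orbit cL cM M_cat (emb_base e) x0 satrN homrN K_nat l0.
  have [x xP] := H _ _ tw ((iso_sat h _ _).1 tw).
  exists x => q /Fl/l0P[z [zl ->]]; apply/pfE.
  by have [k <-] := wl0 z zl; exact: xP.
by move=> x xP; exists x => s a Aa; apply/(pfE (existT _ s a))/xP; exists (existT _ s a).
Qed.

Definition Mset : set (elt (reduct N)) :=
  range (fun z : elt M => emap (emb_base e) z).

Lemma Mset_countable : countable Mset.
Proof. exact: card_le_trans (card_image_le _ _) cM. Qed.

Lemma countable_small (T : Type) (A : set T) : countable A -> small K A.
Proof. exact: small_le. Qed.

Variable A : set (Gext e).
Hypotheses (nA : normal A) (muA : @mu _ _ _ e `<=` A).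

Lemma fix_model_in (N0 : structure L) (e0 : elem_emb N0 (reduct N)) (x : Gext e) :
  countable_structure N0 ->
  (forall s a, gact (x : N None) (e0 s a : N (Some s)) = e0 s a) -> A x.
Proof.
move=> cN0 xe0; case: (nA) => _ AJ.
have [f fP] := emb_range M_cat (emb_base e) e0 cN0.
have xf s m : gact (x : N None) (f s m : N (Some s)) = f s m.
  by have [a <-] := (fP s (f s m)).1 (ex_intro _ m erefl); exact: xe0.
(* [h] takes the standard copy of [M] to the copy fixed by [x]. A group element agreeing with [h] on
   [M] will conjugate [x] into [mu]. *)
have [|h hP] := pelem_hom homrN (pelem_span (emb_base e) f).
  apply: countable_small; apply: sub_countable (subset_card_le _) Mset_countable.
  by move=> [s a] [b [m [/= -> _]]]; exists (existT _ s m).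
have [g gP] : exists g : N None, forall s (a : reduct N s),
    Mset (existT _ s a) -> gact g a = h s a.
  apply: (@aut_realized h Mset (Mset `|` emap h @` Mset)).
  - apply: countable_small; apply: countableU; first exact: Mset_countable.
    exact: card_le_trans (card_image_le _ _) Mset_countable.
  - by move=> z; left.
  - by move=> z Mz; right; exists z.
have gM s (m : M s) : gact g (e (Some s) m) = f s m.
  rewrite gP; first by apply: hP; exists m.
  by exists (existT _ s m).
have : A (x ^ (g : Gext e))%g.
  apply: muA; apply/muP => s m.
  by rewrite conjgE !gactM gM xf -gM -gactM mulVg gact1.
by move=> /(AJ _ (g : Gext e)^-1%g); rewrite -conjgM mulgV conjg1.
Qed.

Lemma aut_coset (t : aut N) (x : Gext e) :
  (forall s (a : expansion M s), t s (e s a) = e s a) ->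
  A (x^-1 * (t None x : Gext e))%g.
Proof.
move=> tM; case: (nA) => -[A1 AM AV] AJ.
pose ax (z : elt (reduct N)) : elt (reduct N) := emap (act_aut x) z.
pose A0 := Mset `|` ax @` Mset.
have cA0 : countable A0.
  apply: countableU; first exact: Mset_countable.
  exact: card_le_trans (card_image_le _ _) Mset_countable.
have [y yP] : exists y : N None, forall s (a : reduct N s),
    A0 (existT _ s a) -> gact y a = t (Some s) a.
  apply: (@aut_realized (iso_reduct t) A0 (A0 `|` emap (iso_reduct t) @` A0)).
  - apply: countable_small; apply: countableU => //.
    exact: card_le_trans (card_image_le _ _) cA0.
  - by move=> z; left.
  - by move=> z Mz; right; exists z.
have yM s (m : M s) : gact y (e (Some s) m) = e (Some s) m.
  by rewrite yP; [exact: tM|left; exists (existT _ s m)].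
have yxM s (m : M s) :
    gact y (gact (x : N None) (e (Some s) m)) = gact (t None x) (e (Some s) m).
  rewrite yP; first by rewrite iso_gact tM.
  by right; exists (emap (emb_base e) (existT _ s m)) => //; exists (existT _ s m).
pose y' : Gext e := y; pose tx : Gext e := t None x.
have Ay : A y' by apply: muA; apply/muP.
have Az : A (tx^-1 * (y' * x))%g.
  by apply: muA; apply/muP => s m; rewrite !gactM yxM -gactM mulVg gact1.
(* The product of [x^-1 y x] and [x^-1 y^-1 tx], the second being the inverse of the element just
   shown to lie in [A], is [x^-1 tx]. *)
have := AM _ _ (AJ _ x Ay) (AV _ Az).
by rewrite conjgE !invgM invgK -!mulgA !mulVKg.
Qed.

End Realize.

(** * The isomorphism *)

Lemma emb_gact (L : lang) (M : structure L) (P Q : structure (elang M))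
    (j : elem_emb P Q) (x : P None) s (a : P (Some s)) :
  gact (j None x) (j (Some s) a) = j (Some s) (gact x a).
Proof.
pose g : idx 3 -> srt (elang M) :=
  scons (Some s) (scons None (scons (Some s) (@nilc _))).
pose v0 : term (L := elang M) g (Some s) := Var (L := elang M) g None.
pose v1 : term (L := elang M) g None := Var (L := elang M) g (Some None).
pose v2 : term (L := elang M) g (Some s) :=
  Var (L := elang M) g (Some (Some None)).
have E (R : structure (elang M)) (w : forall i, R (g i)) :
    sat (Eq v0 (tact v1 v2)) w <->
    w None = gact (w (Some None)) (w (Some (Some None))).
  have -> : gact (w (Some None)) (w (Some (Some None))) = eval w (tact v1 v2).
    by rewrite eval_tact.
  by [].
pose w : forall i, P (g i) :=
  vcons (M := P) (s := (Some s : srt (elang M))) (gact x a)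
    (vcons (M := P) (s := (None : srt (elang M))) x
      (vcons (M := P) (s := (Some s : srt (elang M))) a (@nilv _ P))).
by have /E -> := (emb_elem j (Eq v0 (tact v1 v2)) w).1 ((E P w).2 erefl).
Qed.

Lemma ran_add1 (L : lang) (P N : structure L) (R : forall s, P s -> N s -> Prop)
    s (c : P s) (x : N s) :
  countable (ran R) -> countable (ran (add1 R c x)).
Proof.
move=> cR; apply: sub_countable (subset_card_le _)
  (countableU cR (countable1 (existT _ s x))).
by move=> [s' b] [a /= []]; [left; eexists; eassumption|right].
Qed.

Section Main.
Variables (L : lang) (M : structure L) (M1 M2 : structure (elang M)).
Variables (i : elem_emb (expansion M) M1) (j : elem_emb M1 M2) (K1 K2 : Type).
Local Notation S := (srt L).
Local Notation EL := (elang M).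
Hypotheses (cL : countable_lang L) (cM : countable_structure M).
Hypothesis M_cat : forall P : structure L,
  countable_structure P -> elem_equiv M P -> isomorphic M P.
Variable m0 : elt M.
Hypotheses (K1_large : large K1 (expansion M)) (K2_large : large K2 M1).
Hypothesis sat1 : saturated K1 M1.
Hypotheses (sat2 : saturated K2 M2) (hom2 : strongly_homogeneous K2 M2).
Hypotheses (satr2 : saturated K2 (reduct M2)).
Hypotheses (homr2 : strongly_homogeneous K2 (reduct M2)).

Local Notation e := (emb_comp i j).
Local Notation G2 := (Gext e).
Local Notation G1 := (Gext i).

Let K1_nat : small K1 [set: nat].
Proof. by case: K1_large => _ /small_le; apply; exact: nat_le_formula. Qed.

Let K2_nat : small K2 [set: nat].
Proof. by case: K2_large => _ /small_le; apply; exact: nat_le_formula. Qed.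

Let x0 : elt (reduct M2) := emap (emb_base e) m0.

Lemma coset_rep (A : set G2) (x : G2) :
  normal A -> @mu _ _ _ e `<=` A -> exists g : M1 None, A (x^-1 * (j None g : G2))%g.
Proof.
move=> nA muA.
pose R := fun s (a : M2 s) (b : M1 s) => exists c, a = e s c /\ b = i s c.
have [|g gP] := @pelem_ext _ M2 M1 K1 _ _ (x : M2 None) sat1 (pelem_span e i).
  apply: small_le K1_large.1 _; apply: card_le_trans (subset_card_le _)
    (card_image_le (emap i) _).
  by move=> [s b] [a [c [_ /= ->]]]; exists (existT _ s c).
(* Followed by [j], the map becomes elementary from [M2] to itself, fixes [M] and sends [x] to the
   image of [g]. *)
have eR2 := pelem_post j gP.
have [t tP] : exists t : aut M2, forall s a b,
    (exists c, add1 R x g a c /\ b = j s c) -> t s a = b.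
  apply: pelem_hom hom2 eR2 _.
  apply: small_le K2_large.1 _.
  (* The domain is small for [K2] because matching is injective, so [M1] covers it. *)
  have H (z : elt M1) : exists y : elt M2, forall a,
      add1 R x g a (projT2 z) -> y = existT _ (projT1 z) a.
    case: (EM (exists a, add1 R x g a (projT2 z))) => [[a ha]|h].
      exists (existT _ _ a) => a' ha'.
      by have -> := (pelem_inj gP ha ha').2 erefl.
    by exists (emap j z) => a ha; case: h; exists a.
  have [f fP] := choice H.
  apply: card_le_trans (subset_card_le _) (card_image_le f _).
  move=> [s a] [b [c [hc _]]]; exists (existT _ s c) => //.
  exact: (fP (existT _ s c)).
exists g; have -> : (j None g : G2) = t None x.
  by apply/esym/tP; exists g; split=> //; exact: AddNew.
apply: (aut_coset cL cM M_cat x0 sat2 satr2 homr2 K2_nat nA muA).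
move=> s a; apply: tP; exists (i s a); split=> //.
by apply: AddOld; exists a.
Qed.

Lemma normal_in_class (A : set G2) :
  normal A -> @mu _ _ _ e `<=` A -> @G000top_class K2 _ _ _ e A.
Proof.
move=> nA muA; case: (nA) => -[A1 AM AV] AJ; split=> //.
  apply: small_le K2_large.1 _.
  (* Every coset has a representative from [M1], which bounds the index; elements of the other sorts
     get a dummy value. *)
  pose f (z : elt M1) : set G2 := match z with
    | existT None y => coset A (j None y : G2)
    | existT (Some _) _ => set0
    end.
  apply: card_le_trans (subset_card_le _) (card_image_le f _).
  move=> _ [x _ <-]; have [g xg] := coset_rep x nA muA.
  exists (existT _ None g) => //=; apply/seteqP; split=> y; rewrite /coset /= => h.
    by have := AM _ _ xg h; rewrite -mulgA mulVKg.
  by have := AM _ _ (AV _ xg) h; rewrite invgM invgK -mulgA mulVKg.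
move=> t tM.
have inA (u : aut M2) (x : G2) :
    (forall s (a : expansion M s), u s (e s a) = e s a) -> A x -> A (u None x : G2).
  move=> uM Ax.
  have := aut_coset cL cM M_cat x0 sat2 satr2 homr2 K2_nat nA muA x uM.
  by move=> /(AM _ _ Ax); rewrite mulVKg.
apply/seteqP; split=> [_ [x Ax <-]|x Ax]; first exact: inA.
exists (isov t x); last by rewrite isovK.
by apply: (inA (t^-1)%g) => // s a; rewrite -[in LHS](tM s a); exact: isofK.
Qed.

Lemma G000top_sub (A : set G2) :
  normal A -> @mu _ _ _ e `<=` A -> @G000top_set K2 _ _ _ e `<=` A.
Proof. by move=> nA muA x; apply; split=> //; exact: normal_in_class. Qed.

Lemma mu_sub_G000top : @mu _ _ _ e `<=` @G000top_set K2 _ _ _ e.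
Proof. by move=> x xmu A [_]; apply. Qed.

Lemma small_reduct1 : small K2 [set: elt (reduct M1)].
Proof.
apply: small_le K2_large.1 _.
pose f (z : elt M1) : elt (reduct M1) := match z with
  | existT None _ => emap (emb_base i) m0
  | existT (Some s) y => existT (reduct M1) s y
  end.
apply: card_le_trans (subset_card_le _) (card_image_le f _).
by move=> [s y] _; exists (existT M1 (Some s) y).
Qed.

(** Homogeneity of the reduct extends [h] to an automorphism of [M2], and [aut_realized] replaces it
    on the small set [M1] by a group element. *)
Lemma restrict_ext (h : aut (reduct M1)) : exists x : G2, restricts_to x h.
Proof.
pose jr := emb_reduct j.
have [|k kP] := pelem_hom homr2 (pelem_span jr (emb_comp (iso_emb h) jr)).
  apply: small_le small_reduct1 _.
  apply: card_le_trans (subset_card_le _) (card_image_le (emap jr) _).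
  move=> [s a] [b [c [/= ac _]]]; exists (existT _ s c) => //; by rewrite ac.
pose B : set (elt (reduct M2)) := range (fun z : elt (reduct M1) => emap jr z).
have [x xP] : exists x : M2 None, forall s (a : reduct M2 s),
    B (existT _ s a) -> gact x a = k s a.
  apply: (aut_realized e cL cM M_cat x0 sat2 satr2 homr2 K2_nat (B := B)) => //.
    exact: small_le small_reduct1 (card_image_le _ _).
  move=> _ [[s a] _ <-]; exists (existT _ s (h s a)) => //.
  by rewrite /emap /=; congr existT; apply/esym/kP; exists a.
exists x => s a; rewrite xP; last by exists (existT _ s a).
by apply: kP; exists a.
Qed.

Lemma restricts_Hstab (x : G2) h : restricts_to x h -> Hstab x.
Proof.
move=> xh s; apply/seteqP; split=> [_ [_ [a _ <-] <-]|_ [a _ <-]].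
  by exists (h s a) => //; rewrite xh.
exists (j (Some s) (isov h a)); first by exists (isov h a).
by rewrite xh isovK.
Qed.

Lemma restrictsM (x y : G2) h k :
  restricts_to x h -> restricts_to y k -> restricts_to (x * y)%g (h * k)%g.
Proof. by move=> xh yk s a; rewrite gactM yk xh. Qed.

Lemma restrictsV (x : G2) h : restricts_to x h -> restricts_to x^-1%g h^-1%g.
Proof.
move=> xh s a; rewrite -[in LHS](isovK h a) -xh.
by rewrite -gactM mulVg gact1.
Qed.

Lemma restricts_mu (x : G2) (h : aut (reduct M1)) : restricts_to x h ->
  (forall s (m : M s), h s (i (Some s) m : reduct M1 s) = i (Some s) m) -> mu x.
Proof. by move=> xh hM; apply/muP => s m; rewrite [in LHS]/= xh hM. Qed.

(** Independence of the choice of lift: the automorphisms all of whose lifts lie in [G000top] form a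
    subgroup, so generators suffice. *)
Lemma AutfL_G000top (x : G2) (h : aut (reduct M1)) :
  restricts_to x h -> @AutfL_set K1 _ (reduct M1) h -> @G000top_set K2 _ _ _ e x.
Proof.
have nA := @G000top_normal K2 _ _ _ e; case: (nA) => -[A1 AM AV] AJ.
move=> + hA; move: x; apply: (hA [set k | forall x : G2, restricts_to x k ->
  @G000top_set K2 _ _ _ e x]); split.
  split=> [x xh|k k' kA k'A x xkk'|k kA x xk] /=.
  - by apply: mu_sub_G000top; exact: (restricts_mu xh).
  (* A lift [y] of [k] splits [x] into lifts of the two factors. *)
  - have [y yk] := restrict_ext k.
    have := AM _ _ (kA _ yk) (k'A (y^-1 * x)%g _); rewrite mulVKg; apply.
    by have := restrictsM (restrictsV yk) xkk'; rewrite mulKg.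
  - have := restrictsV xk; rewrite invgK => /kA /AV.
    by rewrite invgK.
move=> k [N0 [e0 [_ ke0]]] x xk.
have [z] : exists z : elt N0, True.
  case: m0 => s m.
  have /sat_Ex[y _] : sat (Ex (s := s) (Not (Bot _))) (@nilv _ N0).
    rewrite (elem_equiv_emb e0) -(elem_equiv_emb (emb_base i)) sat_Ex.
    by exists m.
  by exists (existT _ s y).
(* The model fixed by [k] may be uncountable; a countable submodel is fixed as well, and
   categoricity applies to that one. *)
move=> _; have [N1 [e1 [cN1 _]]] := countable_submodel z cL (@countable0 (elt N0)).
apply: (fix_model_in cL cM M_cat x0 sat2 satr2 homr2 K2_nat nA mu_sub_G000top
  (e0 := emb_comp e1 (emb_comp e0 (emb_reduct j))) cN1) => s a.
by rewrite /= xk ke0.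
Qed.

(** [R] identifies parameters of [M2] with countably many elements of [M1], so that the type of [x]
    over them can be realized in [M1]. Since [R] is arbitrary, further elements can be realized over
    earlier ones. *)
Definition approximable (x : G2) :=
  forall R : forall s, M2 s -> M1 s -> Prop, pelem R -> countable (ran R) ->
    (forall s (m : M s), R (Some s) (e (Some s) m) (i (Some s) m)) ->
    exists y : G1, @AutfL_set K1 _ (reduct M1) (act_aut y) /\
      pelem (add1 R (x : M2 None) (y : M1 None)).

Lemma pelem_ext1 (R : forall s, M2 s -> M1 s -> Prop) s (c : M2 s) :
  pelem R -> countable (ran R) -> exists y : M1 s, pelem (add1 R c y).
Proof.
by move=> eR cR; apply: pelem_ext sat1 eR _; exact: small_le K1_nat cR.
Qed.

Lemma pelem_conj (R : forall s, M2 s -> M1 s -> Prop) (x y : G2) (x' y' d : G1) :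
  pelem R -> R None x x' -> R None y y' -> R None (x ^ y)%g d -> d = (x' ^ y')%g.
Proof.
move=> eR xx' yy'.
pose g : idx 2 -> srt EL := scons None (scons None (@nilc _)).
pose vx : term (L := EL) g None := Var (L := EL) g None.
pose vy : term (L := EL) g None := Var (L := EL) g (Some None).
have := @pelem_term _ _ _ R _ g (vcons (x : M2 None) (vcons (y : M2 None) (@nilv _ M2)))
  (vcons (x' : M1 None) (vcons (y' : M1 None) (@nilv _ M1))) None
  (tmul (tinv vy) (tmul vx vy)) d eR.
rewrite !eval_tmul !eval_tinv => H h.
by apply: H; [case=> [[[]|]|]|exact: h].
Qed.

Lemma pelem_mulV (R : forall s, M2 s -> M1 s -> Prop) (x y : G2) (x' y' d : G1) :
  pelem R -> R None x x' -> R None y y' -> R None (x * y^-1)%g d ->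
  d = (x' * y'^-1)%g.
Proof.
move=> eR xx' yy'.
pose g : idx 2 -> srt EL := scons None (scons None (@nilc _)).
pose vx : term (L := EL) g None := Var (L := EL) g None.
pose vy : term (L := EL) g None := Var (L := EL) g (Some None).
have := @pelem_term _ _ _ R _ g (vcons (x : M2 None) (vcons (y : M2 None) (@nilv _ M2)))
  (vcons (x' : M1 None) (vcons (y' : M1 None) (@nilv _ M1))) None
  (tmul vx (tinv vy)) d eR.
rewrite !eval_tmul !eval_tinv => H h.
by apply: H; [case=> [[[]|]|]|exact: h].
Qed.

(** Fixing each element of [M] belongs to the type of [x] over [M]. Any realization therefore fixes
    the small model [M] pointwise and acts as a generator of the Lascar strong group. *)
Lemma approximable_mu : @mu _ _ _ e `<=` approximable.
Proof.
move=> x /muP xM R eR cR RM; have [y yP] := pelem_ext1 (x : M2 None) eR cR.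
exists y; split=> //.
have yM s (m : M s) : gact y (i (Some s) m) = i (Some s) m.
  pose g : idx 2 -> srt EL := scons None (scons (Some s) (@nilc _)).
  pose v0 : term (L := EL) g None := Var (L := EL) g None.
  pose v1 : term (L := EL) g (Some s) := Var (L := EL) g (Some None).
  pose v (P : structure EL) (a : P None) (b : P (Some s)) : forall i, P (g i) :=
    vcons (M := P) (s := (None : srt EL)) a
      (vcons (M := P) (s := (Some s : srt EL)) b (@nilv _ P)).
  have := @pelem_term _ _ _ _ _ g (v _ (x : M2 None) (e (Some s) m))
    (v _ y (i (Some s) m)) (Some s) (tact v0 v1) (i (Some s) m) yP.
  rewrite !eval_tact => H; apply/esym; apply: H.
    by case=> [[[]|]|]; [apply: AddOld; exact: RM|exact: AddNew].
  by apply: AddOld; have := RM s m; rewrite -[X in R _ X _](xM s m).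
move=> B [_]; apply; exists M, (emb_base i); split=> //.
apply: small_le K1_nat cM.
Qed.

Lemma approximable_normal : normal approximable.
Proof.
have nF := @AutfL_normal K1 _ (reduct M1); case: (nF) => -[F1 FM FV] FJ.
have mulV x y : approximable x -> approximable y -> approximable (x * y^-1)%g.
  move=> xP yP R eR cR RM.
  have [x' [Fx' ex]] := xP R eR cR RM.
  have [|y' [Fy' ey]] := yP _ ex (ran_add1 _ _ cR); first by move=> s m; apply: AddOld.
  (* [z] is introduced only to put the quotient into the domain; being related to it by an
     elementary map, it must equal [x' * y'^-1]. *)
  have [z ez] := pelem_ext1 ((x * y^-1)%g : M2 None) ey (ran_add1 _ _ (ran_add1 _ _ cR)).
  have zE : z = (x' * y'^-1 : G1)%g.
    apply: (pelem_mulV (x := x) (y := y) ez); last exact: AddNew.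
      by apply/AddOld/AddOld/AddNew.
    by apply/AddOld/AddNew.
  exists (x' * y'^-1)%g; split.
    by rewrite act_autM act_autV; apply: FM => //; exact: FV.
  rewrite -zE; apply: pelem_sub ez => s a b [s' a' b' h|]; last exact: AddNew.
  by apply/AddOld/AddOld/AddOld.
have one : approximable 1%g.
  by apply: approximable_mu; apply/muP => s m; rewrite gact1.
have inv x : approximable x -> approximable x^-1%g.
  by move=> xP; rewrite -[x^-1%g]mul1g; exact: mulV.
split; first split=> // x y xP yP.
  by rewrite -[y]invgK; apply: mulV => //; exact: inv.
move=> x y xP R eR cR RM.
(* The conjugator may have any realization, because [AutfL] is normal. It is realized first, so that
   [x] is then approximated over it. *)
have [y' ey] := pelem_ext1 (y : M2 None) eR cR.
have [|x' [Fx' ex]] := xP _ ey (ran_add1 _ _ cR); first by move=> s m; apply: AddOld.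
have [z ez] := pelem_ext1 ((x ^ y)%g : M2 None) ex (ran_add1 _ _ (ran_add1 _ _ cR)).
have zE : z = (x' ^ (y' : G1) : G1)%g.
  apply: (pelem_conj (x := x) (y := y) ez); last exact: AddNew.
    by apply/AddOld/AddNew.
  by apply/AddOld/AddOld/AddNew.
exists (x' ^ (y' : G1))%g; split.
  by rewrite conjgE !act_autM act_autV -conjgE; exact: FJ.
rewrite -zE; apply: pelem_sub ez => s a b [s' a' b' h|]; last exact: AddNew.
by apply/AddOld/AddOld/AddOld.
Qed.

(** Take for [R] the inverse of [j] on [M] and [h(M)]. That [x] acts on [M] as [h] is part of its
    type over these parameters, so the approximant [y] agrees with [h] on [M], and [y^-1 h] fixes
    [M]. *)
Lemma G000top_AutfL (x : G2) (h : aut (reduct M1)) :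
  restricts_to x h -> @G000top_set K2 _ _ _ e x -> @AutfL_set K1 _ (reduct M1) h.
Proof.
move=> xh /(G000top_sub approximable_normal approximable_mu) xP.
case: (@AutfL_normal K1 _ (reduct M1)) => -[F1 FM FV] _.
pose ran0 : set (elt M1) := (fun z : elt M => existT M1 (Some (projT1 z))
    (i (Some (projT1 z)) (projT2 z))) @` setT `|`
  (fun z : elt M => existT M1 (Some (projT1 z))
    (h _ (i (Some (projT1 z)) (projT2 z) : reduct M1 _))) @` setT.
pose R s (a : M2 s) (b : M1 s) := j s b = a /\ ran0 (existT _ s b).
have eR : pelem R.
  move=> n g p v w vw; have -> : v = fun k => j _ (w k).
    by apply: functional_extensionality_dep => k; case: (vw k).
  by rewrite -emb_elem.
have cR : countable (ran R).
  have c0 : countable ran0.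
    by apply: countableU; exact: card_le_trans (card_image_le _ _) cM.
  by apply: sub_countable (subset_card_le _) c0 => -[s b] [a []].
have [|y [Fy ey]] := xP R eR cR.
  by move=> s m; split=> //; left; exists (existT _ s m).
have yM s (m : M s) : gact (y : M1 None) (i (Some s) m) = h s (i (Some s) m).
  pose g : idx 2 -> srt EL := scons None (scons (Some s) (@nilc _)).
  pose v0 : term (L := EL) g None := Var (L := EL) g None.
  pose v1 : term (L := EL) g (Some s) := Var (L := EL) g (Some None).
  pose v (P : structure EL) (a : P None) (b : P (Some s)) : forall i, P (g i) :=
    vcons (M := P) (s := (None : srt EL)) a
      (vcons (M := P) (s := (Some s : srt EL)) b (@nilv _ P)).
  have := @pelem_term _ _ _ _ _ g (v _ (x : M2 None) (e (Some s) m))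
    (v _ (y : M1 None) (i (Some s) m)) (Some s) (tact v0 v1)
    (h s (i (Some s) m)) ey.
  rewrite !eval_tact => H; apply/esym; apply: H.
    case=> [[[]|]|]; last exact: AddNew.
    by apply: AddOld; split=> //; left; exists (existT _ s m).
  by apply: AddOld; split; [rewrite -xh|right; exists (existT _ s m)].
have : @AutfL_set K1 _ (reduct M1) ((act_aut y)^-1 * h)%g.
  move=> B [_]; apply; exists M, (emb_base i); split; first exact: small_le K1_nat cM.
  by move=> s m /=; rewrite -yM -gactM mulVg gact1.
by move=> /(FM _ _ Fy); rewrite mulVKg.
Qed.

Lemma emb_restricts (g : G1) : restricts_to (j None g : G2) (act_aut g).
Proof. by move=> s a; rewrite emb_gact. Qed.

Lemma rho_iso : exists rho : quot (AutfL K1 (reduct M1)) -> quot (G000top K2 e),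
  [/\ is_rho rho, {morph rho : a b / (a * b)%g} & bijective rho].
Proof.
pose X h := projT1 (cid (restrict_ext h)).
have XP h : restricts_to (X h) h := projT2 (cid (restrict_ext h)).
pose rho (q : quot (AutfL K1 (reduct M1))) : quot (G000top K2 e) :=
  \pi_(quot (G000top K2 e)) (X (repr q)).
have rhoE h x : restricts_to x h -> rho (\pi_(quot _) h) = \pi_(quot _) x.
  move=> xh; apply/quotE; rewrite /coset /=.
  apply: (AutfL_G000top (restrictsM (restrictsV (XP _)) xh)).
  by apply/(quotE (AutfL K1 (reduct M1))); rewrite reprK.
exists rho; split.
- move=> h; split=> [|x _]; last exact: rhoE.
  by exists (X h); split=> //; exact: restricts_Hstab (XP h).
- elim/(@quotW _ (quot (AutfL K1 (reduct M1)))) => h;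
  elim/(@quotW _ (quot (AutfL K1 (reduct M1)))) => k.
  rewrite -[(_ * _)%g](pi_quotM (AutfL K1 (reduct M1)) h k) (rhoE _ _ (restrictsM (XP h) (XP k))).
  by rewrite pi_quotM (rhoE _ _ (XP h)) (rhoE _ _ (XP k)).
- have rI : injective rho.
    elim/(@quotW _ (quot (AutfL K1 (reduct M1)))) => h;
    elim/(@quotW _ (quot (AutfL K1 (reduct M1)))) => k.
    rewrite (rhoE _ _ (XP h)) (rhoE _ _ (XP k)) => /quotE hk; apply/quotE.
    exact: G000top_AutfL (restrictsM (restrictsV (XP h)) (XP k)) hk.
  have rS q : exists p, rho p = q.
    elim/(@quotW _ (quot (G000top K2 e))): q => x.
    (* The coset contains an element coming from [M1], which is a lift of its own action on [M1]. *)
    have [g xg] := coset_rep x (@G000top_normal K2 _ _ _ e) mu_sub_G000top.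
    exists (\pi_(quot _) (act_aut (g : G1))); rewrite (rhoE _ _ (emb_restricts g)).
    exact/esym/quotE.
  have [r rP] := choice rS.
  by exists r => // p; apply: rI; rewrite rP.
Qed.

End Main.

Theorem lemma5p18 (L : lang) (M : structure L)
    (M1 M2 : structure (elang M))
    (i : elem_emb (expansion M) M1) (j : elem_emb M1 M2)
    (K1 K2 : Type)
    (M_countable : countable_structure M)
    (M_omega_cat : omega_categorical M)
    (M_eq : equals_eq M)
    (K1_large : large K1 (expansion M))
    (M1_monster : monster K1 M1)
    (M1_reduct_monster : monster K1 (reduct M1))
    (K2_large : large K2 M1)
    (M2_monster : monster K2 M2)
    (M2_reduct_monster : monster K2 (reduct M2)) :
  exists rho : quot (AutfL K1 (reduct M1)) ->
               quot (G000top K2 (emb_comp i j)),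
    [/\ is_rho rho,
        {morph rho : a b / (a * b)%g} &
        bijective rho].
Proof.
case: M_omega_cat => cS cF cR M_cat.
case: M1_monster => _ sat1 _; case: M2_monster => _ sat2 hom2.
case: M2_reduct_monster => _ satr2 homr2.
(* The quotient of the empty product by the full relation is a sort with an element. This supplies
   the [m0] used as default value in the constructions. *)
have [|//|//|//|s [f _]] := @M_eq 0 (@nilc _) setT.
  exists 0, (fun k : void => match k with end).
  by exists (Not (Bot _)) => v; split=> // _ [].
apply: (@rho_iso L M M1 M2 i j K1 K2) => //.
exact: existT M s (f (@nilv _ M)).
Qed.
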